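(* Consider an $n$-dimensional linear Hopf manifold and the Hermitian curvature flow $\dot g=-S+aQ^1+bQ^2+cQ^3+dQ^4$ with real coefficients $a,b,c,d$. Let $F=F(a,b,c,d,n)=(n-2)a-2b+(n-1)^2c-(n-1)d$ and suppose that $F<n$. Then the metric $g\left(1,\frac{F}{n-F}\right)$ (as well as any of its positive multiples) is static for the flow. Moreover, any metric $g(\alpha_0,\beta_0)$ (with $\alpha_0>0$, $\beta_0>-\alpha_0$) evolves along the flow so that the ratio $\gamma=\frac{\beta}{\alpha}$ of the evolving metric $g(\alpha(t),\beta(t))$ converges to $\frac{F}{n-F}$.
   Context: A linear Hopf manifold of complex dimension $n$ is $M^n=(\mathbb C^n\setminus\{0\})/\!\sim$, where $(z_1,\dots,z_n)\sim(a_1z_1,\dots,a_nz_n)$ for fixed $(a_1,\dots,a_n)\in\mathbb C^n\setminus\{0\}$ with $|a_1|=\dots=|a_n|\ne1$, with its natural complex structure. For real $\alpha>0$, $\beta>-\alpha$, $g(\alpha,\beta)$ is the Hermitian metric $g(\alpha,\beta)_{i\bar j}=\alpha\frac{\delta_{ij}}{|z|^2}+\beta\frac{\bar z_iz_j}{|z|^4}$. The HCFs preserve this family, so a flow starting at $g(\alpha_0,\beta_0)$ is of the form $g(\alpha(t),\beta(t))$; convergence of $\gamma$ is as $t$ tends to the end of the interval of existence. In the flow, with $\Omega^{Ch}$ and $T=T^{Ch}$ the curvature and torsion of the Chern connection (torsion indices lowered by $g$, $T_{ik\bar n}=T_{ik}^pg_{p\bar n}$, $T_{\bar j\bar l m}=\overline{T_{jl\bar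 m}}$), $S_{i\bar j}=g^{k\bar l}\Omega^{Ch}_{k\bar li\bar j}$, and $Q^1_{i\bar j}=g^{k\bar l}g^{m\bar n}T_{ik\bar n}T_{\bar j\bar lm}$, $Q^2_{i\bar j}=g^{k\bar l}g^{m\bar n}T_{km\bar j}T_{\bar l\bar ni}$, $Q^3_{i\bar j}=g^{k\bar l}g^{m\bar n}T_{ik\bar l}T_{\bar j\bar nm}$, $Q^4_{i\bar j}=\frac12g^{k\bar l}g^{m\bar n}(T_{mk\bar l}T_{\bar n\bar ji}+T_{mi\bar j}T_{\bar n\bar lk})$. A metric is static for the flow if the flow acts on it by homotheties, i.e. the solution starting at it consists of positive multiples of it.
   Formalization: The convergence of the ratio γ is stated only for n ≥ 2, since for n = 1 the metric g(α,β) depends only on α+β, so that β/α is not determined by the evolving metric; the claim about static metrics covers all n ≥ 1. *)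

(* Defs.v *)
From HB Require Import structures.
From mathcomp Require Import all_boot all_order all_algebra.
From mathcomp Require Import complex.
From mathcomp Require Import all_classical all_reals all_analysis.

Set Implicit Arguments.
Unset Strict Implicit.
Unset Printing Implicit Defensive.

Import Order.TTheory GRing.Theory Num.Theory.
Import numFieldNormedType.Exports.

Local Open Scope classical_set_scope.
Local Open Scope ring_scope.

(* Everything is written in the global coordinate z of C^n \ {0}: tensors on   *)
(* the Hopf manifold are the tensors on C^n \ {0} invariant under the deck     *)
(* transformation.  The values of functions at z = 0 are irrelevant throughout.*)
(* R[i]^o is R[i] with the topology of its norm.                               *)

Section Calculus.
Variables (R : realType) (n : nat).
Implicit Types (f : 'rV[R[i]]_n -> R[i]) (v z : 'rV[R[i]]_n).

Definition diffquot f v z (s : R) : R[i]^o :=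
  (s^-1)%:C%C * (f (z + s%:C%C *: v) - f z).

(* derivative in the real direction v of C^n = R^2n *)
Definition dderivable f v z : Prop := cvg (diffquot f v z @ 0^').
Definition dderiv f v z : R[i] := lim (diffquot f v z @ 0^').

(* Wirtinger derivatives d/dz_k and d/d(conj z_k) *)
Definition dz (k : 'I_n) f z : R[i] :=
  (dderiv f 'e_k z - 'i * dderiv f ('i *: 'e_k) z) / 2.
Definition dzbar (k : 'I_n) f z : R[i] :=
  (dderiv f 'e_k z + 'i * dderiv f ('i *: 'e_k) z) / 2.

Fixpoint Ck_off0 (m : nat) f : Prop :=
  (forall z, z != 0 ->
    {for z, continuous (f : 'rV[R[i]^o]_n -> R[i]^o)}) /\
  (if m is m'.+1 then
     forall v, (forall z, z != 0 -> dderivable f v z) /\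
               Ck_off0 m' (dderiv f v)
   else True).

Definition smooth_off0 f : Prop := forall m, Ck_off0 m f.

End Calculus.

Section HermitianGeometry.
Variables (R : realType) (n : nat).
Implicit Types (mu z : 'rV[R[i]]_n) (g : 'rV[R[i]]_n -> 'M[R[i]]_n).

(* mu = (a_1, ..., a_n) generates the group of deck transformations. *)
Definition hopf_multiplier mu : Prop :=
  [/\ mu != 0, forall i j, `|mu 0 i| = `|mu 0 j| & forall i, `|mu 0 i| != 1].

Definition deck mu z : 'rV[R[i]]_n := \row_i (mu 0 i * z 0 i).

(* The metric has components g_{i jbar} = g z i j, i.e. the squared norm of v  *)
(* is the sum of g_{i jbar} v_i conj(v_j).                                     *)
Definition hermitian_metric mu g : Prop :=
  [/\ forall i j, smooth_off0 (fun z => g z i j),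
      forall z, z != 0 -> g z \is hermsymmx,
      forall z (v : 'rV[R[i]]_n), z != 0 -> v != 0 ->
        0 < \sum_i \sum_j g z i j * v 0 i * (v 0 j)^* &
      forall z i j, z != 0 ->
        g (deck mu z) i j * mu 0 i * (mu 0 j)^* = g z i j].

(* g^{k lbar}, with sum_l g^{k lbar} g_{i lbar} = delta_{ik}: the transpose of  *)
(* the inverse matrix.                                                         *)
Definition ginv g z (k l : 'I_n) : R[i] := invmx (g z) l k.

(* Chern connection: nabla_i d_k = Gamma_{ik}^p d_p, the (0,1) part being the   *)
(* dbar operator.                                                              *)
Definition Gamma g (i k p : 'I_n) z : R[i] :=
  \sum_q ginv g z p q * dz i (fun w => g w k q) z.

Definition torsion g (i k p : 'I_n) z : R[i] := Gamma g i k p z - Gamma g k i p z.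

(* T_{ik nbar} *)
Definition tors g z (i k n' : 'I_n) : R[i] :=
  \sum_p torsion g i k p z * g z p n'.

(* T_{jbar lbar m} *)
Definition torsbar g z (j l m : 'I_n) : R[i] := (tors g z j l m)^*.

(* Omega_{k lbar i jbar} = g(R(d_k, d_lbar) d_i, d_jbar) *)
Definition curv g z (k l i j : 'I_n) : R[i] :=
  \sum_p - dzbar l (Gamma g k i p) z * g z p j.

Definition Sric g z : 'M[R[i]]_n :=
  \matrix_(i, j) \sum_k \sum_l ginv g z k l * curv g z k l i j.

Definition Q1 g z : 'M[R[i]]_n :=
  \matrix_(i, j) \sum_k \sum_l \sum_m \sum_p
    ginv g z k l * ginv g z m p * (tors g z i k p * torsbar g z j l m).

Definition Q2 g z : 'M[R[i]]_n :=
  \matrix_(i, j) \sum_k \sum_l \sum_m \sum_p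
    ginv g z k l * ginv g z m p * (tors g z k m j * torsbar g z l p i).

Definition Q3 g z : 'M[R[i]]_n :=
  \matrix_(i, j) \sum_k \sum_l \sum_m \sum_p
    ginv g z k l * ginv g z m p * (tors g z i k l * torsbar g z j p m).

Definition Q4 g z : 'M[R[i]]_n :=
  \matrix_(i, j) (2^-1 * \sum_k \sum_l \sum_m \sum_p
    ginv g z k l * ginv g z m p *
      (tors g z m k l * torsbar g z p j i + tors g z m i j * torsbar g z p l k)).

Definition hcf_rhs (a b c d : R) g z : 'M[R[i]]_n :=
  - Sric g z + a%:C%C *: Q1 g z + b%:C%C *: Q2 g z
             + c%:C%C *: Q3 g z + d%:C%C *: Q4 g z.

End HermitianGeometry.

Section Flow.
Variables (R : realType) (n : nat) (mu : 'rV[R[i]]_n) (a b c d : R).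
Implicit Types (T : \bar R) (g : R -> 'rV[R[i]]_n -> 'M[R[i]]_n).

(* A solution on [0, T[ in the space of metrics of the Hopf manifold; the time *)
(* derivative is one-sided at t = 0.                                           *)
Definition hcf_solution T g : Prop :=
  (0 < T)%E /\
  forall t : R, 0 <= t -> (t%:E < T)%E ->
    hermitian_metric mu (g t) /\
    forall z i j, z != 0 ->
      (fun s : R => ((s - t)^-1)%:C%C * (g s z i j - g t z i j) : R[i]^o)
        @ within [set s | 0 <= s] t^'
      --> (hcf_rhs a b c d (g t) z i j : R[i]^o).

Definition hcf_maximal T g : Prop :=
  hcf_solution T g /\
  forall T' g', (T < T')%E -> hcf_solution T' g' ->
    ~ (forall t z, 0 <= t -> (t%:E < T)%E -> z != 0 -> g' t z = g t z).

Definition static_metric (g0 : 'rV[R[i]]_n -> 'M[R[i]]_n) : Prop :=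
  exists T g,
    [/\ hcf_maximal T g,
        forall z, z != 0 -> g 0 z = g0 z &
        forall t, 0 <= t -> (t%:E < T)%E ->
          exists2 r : R, 0 < r & forall z, z != 0 -> g t z = r%:C%C *: g0 z].

(* g(alpha, beta) *)
Definition hopf_metric (alpha beta : R) : 'rV[R[i]]_n -> 'M[R[i]]_n := fun z =>
  let r2 := \sum_k `|z 0 k| ^+ 2 in
  \matrix_(i, j) (alpha%:C%C * ((i == j)%:R / r2)
                  + beta%:C%C * ((z 0 i)^* * z 0 j / r2 ^+ 2)).

(* The maximal flow starting at g(alpha0, beta0). *)
Definition hopf_flow (alpha0 beta0 : R) T (alpha beta : R -> R) : Prop :=
  [/\ alpha 0 = alpha0, beta 0 = beta0,
      forall t, 0 <= t -> (t%:E < T)%E -> 0 < alpha t /\ - alpha t < beta t &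
      hcf_maximal T (fun t => hopf_metric (alpha t) (beta t))].

End Flow.

(* t --> T inside [0, T[, for 0 < T <= +oo *)
Definition time_end (R : realType) (T : \bar R) : set_system R :=
  if T is r%:E then r^'- else pinfty_nbhs R.

Definition hopf_F (R : realType) (a b c d : R) (n : nat) : R :=
  (n%:R - 2) * a - 2 * b + (n%:R - 1) ^+ 2 * c - (n%:R - 1) * d.

(* Main.v *)
Require Import Defs.
From mathcomp Require Import all_boot all_order all_algebra.
From mathcomp Require Import complex.
From mathcomp Require Import all_classical all_reals all_analysis.
From mathcomp Require Import ring lra.
Import Order.TTheory GRing.Theory Num.Theory.
Import numFieldNormedType.Exports.
Local Open Scope classical_set_scope.
Local Open Scope ring_scope.

Set Implicit Arguments.
Unset Strict Implicit.
Unset Printing Implicit Defensive.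

(** Everything happens in the two-parameter family g(alpha, beta), so the flow
    is a system of two ordinary differential equations.  Put
    tau = alpha + beta and u = tau / alpha = 1 + gamma.  The lowered torsion
    T_{ik nbar} of g(alpha, beta) is
    tau / |z|^4 (conj z_k delta_in - conj z_i delta_kn), and the inverse metric
    acts on z and conj z as the scalar |z|^2 / tau, so that every contraction
    in S and in the Q^k reduces to a few elementary ones ([contr_basis]).  The
    outcome ([hcf_rhs_hopf]) has the shape of the family again, and the flow
    reads
      alpha' = - n + P u,   tau' = Q u^2,
    with P = 1 + a + 2 b + (n - 1) d and Q = (n - 1) (a + (n - 1) c - 1).
    Since Q = P - (n - F), the ratio obeys u' = u (n - (n - F) u) / alpha.
    Its positive rest point u = n / (n - F), that is
    gamma = F / (n - F), makes alpha' and tau' constant in time with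
    tau' = u alpha': this is the homothetic solution ([hopf_metric_static]).

    For other initial data, measure time by s with ds = dt / alpha.  Then u is
    logistic, hence explicit and convergent to n / (n - F) as s tends to
    infinity, and alpha is explicit too ([ratio_sol], [alpha_sol]).  Going
    back to t is an inverse function argument ([time_change]): t(s) is the
    integral of alpha, T is its supremum, and s tends to infinity as t tends
    to T, whether T is finite or not.

    The flow so obtained is maximal among all flows of Hermitian metrics,
    not only among those that stay in the family.  If T is finite, an
    extension would be continuous and positive definite at time T; then alpha
    would stay above a positive constant near T and t(s) would be unbounded.
    Uniqueness within the family is a Gronwall estimate for the system
    ([hopf_ode_unique]); it applies because the entries of the metric at a
    coordinate vector are alpha and tau as soon as n > 1.

    Smoothness and the Wirtinger derivatives are treated together: all
    functions in sight are polynomials in z_k, conj z_k and 1 / |z|^2, a class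
    that is closed under formal differentiation ([hexpr]). *)

(** * Limits and directional derivatives of complex-valued functions *)

Section ComplexLimits.
Context {R : realType}.
Implicit Types (T : Type).

Lemma cvgCM T (F : set_system T) {FF : Filter F} (f g : T -> R[i]) (a b : R[i]) :
  (f : T -> R[i]^o) @ F --> (a : R[i]^o) -> (g : T -> R[i]^o) @ F --> (b : R[i]^o) ->
  (fun x => f x * g x : R[i]^o) @ F --> (a * b : R[i]^o).
Proof. exact: (@cvgM R[i] T F FF f g a b). Qed.

Lemma cvgCD T (F : set_system T) {FF : Filter F} (f g : T -> R[i]) (a b : R[i]) :
  (f : T -> R[i]^o) @ F --> (a : R[i]^o) -> (g : T -> R[i]^o) @ F --> (b : R[i]^o) ->
  (fun x => f x + g x : R[i]^o) @ F --> (a + b : R[i]^o).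
Proof. exact: (@cvgD R[i] R[i]^o T F FF f g a b). Qed.

Lemma cvgCV T (F : set_system T) {FF : Filter F} (f : T -> R[i]) (a : R[i]) :
  a != 0 -> (f : T -> R[i]^o) @ F --> (a : R[i]^o) ->
  (fun x => (f x)^-1 : R[i]^o) @ F --> (a^-1 : R[i]^o).
Proof. move=> a0; exact: (@cvgV R[i] T F FF f a a0). Qed.

Lemma cvgC_cst T (F : set_system T) {FF : Filter F} (c : R[i]) :
  (fun _ : T => c : R[i]^o) @ F --> (c : R[i]^o).
Proof. exact: cvg_cst. Qed.

Lemma norm_real_complex (x : R) : `|x%:C%C : R[i]| = `|x|%:C%C.
Proof. by rewrite normc_def /= expr0n addr0 sqrtr_sqr. Qed.

Lemma gt0_complex_real (e : R[i]) : 0 < e -> exists2 r : R, 0 < r & e = r%:C%C.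
Proof.
move=> e0; exists (complex.Re e).
  by rewrite -ltcR RRe_real ?gtr0_real.
by rewrite RRe_real ?gtr0_real.
Qed.

(** Real limits can be read off from complex ones, which turns the equation
    for the entries of the metric into one for alpha and beta. *)
Lemma cvg_real_complex T (F : set_system T) {FF : Filter F} (f : T -> R) (a : R) :
  f @ F --> a <-> (fun x => (f x)%:C%C : R[i]^o) @ F --> (a%:C%C : R[i]^o).
Proof.
split=> /cvgrPdist_lt cf; apply/cvgrPdist_lt.
  move=> e /gt0_complex_real[r r0 ->]; have := cf _ r0; apply: filterS => x /=.
  by rewrite -rmorphB /= norm_real_complex ltcR.
move=> e e0; have /cf : (0 : R[i]) < e%:C%C by rewrite ltcR.
by apply: filterS => x /=; rewrite -rmorphB /= norm_real_complex ltcR.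
Qed.

Lemma cvgC_conj T (F : set_system T) {FF : Filter F} (f : T -> R[i]) (a : R[i]) :
  (f : T -> R[i]^o) @ F --> (a : R[i]^o) ->
  (fun x => (f x)^* : R[i]^o) @ F --> (a^* : R[i]^o).
Proof.
move=> /cvgrPdist_lt cf; apply/cvgrPdist_lt => e /cf; apply: filterS => x /=.
by rewrite -rmorphB /= norm_conjC.
Qed.

(** Needed in this form because the codomain of the functions below is the
    ring of complex numbers, whose topology is only found after the cast to
    [R[i]^o]. *)
Lemma cvgC_near T (F : set_system T) {FF : Filter F} (f g : T -> R[i]) (a : R[i]) :
  (\forall x \near F, f x = g x) ->
  (f : T -> R[i]^o) @ F --> (a : R[i]^o) -> (g : T -> R[i]^o) @ F --> (a : R[i]^o).
Proof. by move=> fg; apply: cvg_trans; apply: near_eq_cvg. Qed.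

End ComplexLimits.
Arguments cvgC_cst {R T F FF} c.

Section DirectionalDerivative.
Context {R : realType} {n : nat}.
Implicit Types (f g : 'rV[R[i]]_n -> R[i]) (v z : 'rV[R[i]]_n).

Definition has_dderiv f v z (l : R[i]) : Prop :=
  diffquot f v z @ 0^' --> (l : R[i]^o).

Lemma has_dderiv_dderivable f v z l : has_dderiv f v z l -> dderivable f v z.
Proof. by move=> fl; apply/cvg_ex; exists l. Qed.

Lemma has_dderivE f v z l : has_dderiv f v z l -> dderiv f v z = l.
Proof. by move=> fl; rewrite /dderiv; apply: cvg_lim fl; exact: norm_hausdorff. Qed.

Lemma cvg_real_dnbhs : (fun s : R => s%:C%C : R[i]^o) @ 0^' --> (0 : R[i]^o).
Proof. by apply/(@cvg_real_complex R R 0^' _ id 0)/cvg_within. Qed.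

Lemma has_dderiv_cst (c : R[i]) v z : has_dderiv (fun=> c) v z 0.
Proof.
rewrite /has_dderiv /diffquot; under eq_fun do rewrite subrr mulr0.
exact: cvg_cst.
Qed.

Lemma has_dderiv_coord j v z : has_dderiv (fun z => z 0 j) v z (v 0 j).
Proof.
rewrite /has_dderiv /diffquot; apply: (cvgC_near _ (cvgC_cst (v 0 j))).
near=> s; rewrite !mxE addrAC subrr add0r mulrA -rmorphM /= mulVf ?mul1r//.
by near: s; exact: nbhs_dnbhs_neq.
Unshelve. all: by end_near. Qed.

Lemma has_dderiv_conj f v z l : has_dderiv f v z l ->
  has_dderiv (fun z => (f z)^*) v z l^*.
Proof.
move=> /cvgC_conj h; apply: cvgC_near h; near=> s.
by rewrite /diffquot !rmorphM !rmorphB /= conj_Creal// complex_real.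
Unshelve. all: by end_near. Qed.

(** Differentiability along a line gives continuity along that line; the
    product and quotient rules need it. *)
Lemma has_dderiv_cvg f v z l : has_dderiv f v z l ->
  (fun s : R => f (z + s%:C%C *: v) : R[i]^o) @ 0^' --> (f z : R[i]^o).
Proof.
move=> fl; rewrite -[f z]addr0 -(mul0r l).
apply: cvgC_near (cvgCD (cvgC_cst (f z)) (cvgCM cvg_real_dnbhs fl)); near=> s.
have s0 : s != 0 by near: s; exact: nbhs_dnbhs_neq.
by rewrite /diffquot mulrA -rmorphM /= mulfV// mul1r addrC subrK.
Unshelve. all: by end_near. Qed.

Lemma has_dderivD f g v z l m : has_dderiv f v z l -> has_dderiv g v z m ->
  has_dderiv (fun z => f z + g z) v z (l + m).
Proof.
move=> fl gm; apply: cvgC_near (cvgCD fl gm).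
by near=> s; rewrite /diffquot; ring.
Unshelve. all: by end_near. Qed.

Lemma has_dderivM f g v z l m : has_dderiv f v z l -> has_dderiv g v z m ->
  has_dderiv (fun z => f z * g z) v z (l * g z + f z * m).
Proof.
move=> fl gm.
apply: cvgC_near
  (cvgCD (cvgCM fl (has_dderiv_cvg gm)) (cvgCM (cvgC_cst (f z)) gm)).
by near=> s; rewrite /diffquot; ring.
Unshelve. all: by end_near. Qed.

Lemma has_dderivV f v z l : f z != 0 -> has_dderiv f v z l ->
  has_dderiv (fun z => (f z)^-1) v z (- l / f z ^+ 2).
Proof.
move=> fz0 fl; have fc := has_dderiv_cvg fl.
have ffz0 : f z * f z != 0 by rewrite mulf_neq0.
rewrite -mulN1r expr2.
have nz : \forall s \near 0^', f (z + (s : R)%:C%C *: v) != 0.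
  exact: (@cvgr_neq0 _ R[i]^o _ _ _ _ _ fc fz0).
apply: cvgC_near (cvgCM (cvgCM (cvgC_cst (-1)) fl)
  (cvgCV ffz0 (cvgCM fc (cvgC_cst (f z))))); near=> s.
have fs0 : f (z + s%:C%C *: v) != 0 by near: s.
have s0 : s != 0 by near: s; exact: nbhs_dnbhs_neq.
rewrite /diffquot; field.
by rewrite fz0 fs0 /= fmorph_eq0.
Unshelve. all: by end_near. Qed.

End DirectionalDerivative.

(** * Differentiating polynomials in z, conj z and 1/|z|^2 *)

Section HopfExpressions.
Context {R : realType} {n : nat}.
Implicit Types (f g : 'rV[R[i]]_n -> R[i]) (v z : 'rV[R[i]]_n).

Definition sqnorm z : R[i] := \sum_k `|z 0 k| ^+ 2.

Lemma sqnormE z : sqnorm z = \sum_k z 0 k * (z 0 k)^*.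
Proof. by apply: eq_bigr => k _; rewrite normCK. Qed.

Lemma sqnorm_neq0 z : z != 0 -> sqnorm z != 0.
Proof.
apply: contra_neq => /eqP; rewrite psumr_eq0 => [/allP z0|k _]; last first.
  by rewrite exprn_ge0.
apply/rowP => k; rewrite mxE; apply/eqP.
by have := z0 k (mem_index_enum k); rewrite sqrf_eq0 normr_eq0.
Qed.

(** Syntax for the polynomials in z_k, conj z_k and 1 / |z|^2.  Keeping the
    syntax makes the Wirtinger derivatives of concrete tensors computable by
    reduction. *)
Inductive hexpr : Type :=
  | HCst of R[i] | HZ of 'I_n | HZbar of 'I_n | HInv
  | HAdd of hexpr & hexpr | HMul of hexpr & hexpr.

Fixpoint heval (e : hexpr) z : R[i] :=
  match e with
  | HCst c => c
  | HZ j => z 0 j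
  | HZbar j => (z 0 j)^*
  | HInv => (sqnorm z)^-1
  | HAdd e1 e2 => heval e1 z + heval e2 z
  | HMul e1 e2 => heval e1 z * heval e2 z
  end.

(** Formal d/dz_k, where z and conj z are independent; hence 1 / |z|^2 goes to
    - conj z_k / |z|^4. *)
Fixpoint hdz (k : 'I_n) (e : hexpr) : hexpr :=
  match e with
  | HCst c => HCst 0
  | HZ j => HCst (j == k)%:R
  | HZbar j => HCst 0
  | HInv => HMul (HMul (HCst (-1)) (HZbar k)) (HMul HInv HInv)
  | HAdd e1 e2 => HAdd (hdz k e1) (hdz k e2)
  | HMul e1 e2 => HAdd (HMul (hdz k e1) e2) (HMul e1 (hdz k e2))
  end.

Fixpoint hdzbar (k : 'I_n) (e : hexpr) : hexpr :=
  match e with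
  | HCst c => HCst 0
  | HZ j => HCst 0
  | HZbar j => HCst (j == k)%:R
  | HInv => HMul (HMul (HCst (-1)) (HZ k)) (HMul HInv HInv)
  | HAdd e1 e2 => HAdd (hdzbar k e1) (hdzbar k e2)
  | HMul e1 e2 => HAdd (HMul (hdzbar k e1) e2) (HMul e1 (hdzbar k e2))
  end.

Definition hdderiv v (e : hexpr) : hexpr :=
  \big[HAdd/HCst 0]_k
    HAdd (HMul (HCst (v 0 k)) (hdz k e)) (HMul (HCst (v 0 k)^*) (hdzbar k e)).

Lemma heval_dderiv v e z : heval (hdderiv v e) z =
  \sum_k (v 0 k * heval (hdz k e) z + (v 0 k)^* * heval (hdzbar k e) z).
Proof. by rewrite /hdderiv (big_morph (heval^~ z) (id1 := 0) (op1 := +%R)). Qed.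

Lemma has_dderiv_sum (I : Type) (r : seq I) (f : I -> 'rV[R[i]]_n -> R[i])
    v z (l : I -> R[i]) : (forall k, has_dderiv (f k) v z (l k)) ->
  has_dderiv (fun z => \sum_(k <- r) f k z) v z (\sum_(k <- r) l k).
Proof.
move=> fl; elim: r => [|k r IH].
  by rewrite big_nil; under eq_fun do rewrite big_nil; exact: has_dderiv_cst.
rewrite big_cons; under eq_fun do rewrite big_cons.
exact: (has_dderivD (fl k) IH).
Qed.

Lemma has_dderiv_sqnorm v z : has_dderiv sqnorm v z
  (\sum_k (v 0 k * (z 0 k)^* + (v 0 k)^* * z 0 k)).
Proof.
rewrite (funext sqnormE : sqnorm = _).
apply: has_dderiv_sum => k.
rewrite [X in _ + X]mulrC; apply: has_dderivM; first exact: has_dderiv_coord.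
by apply: has_dderiv_conj; exact: has_dderiv_coord.
Qed.

Lemma has_dderiv_heval e v z : z != 0 ->
  has_dderiv (heval e) v z (heval (hdderiv v e) z).
Proof.
move=> z0; rewrite heval_dderiv; elim: e => [c|j|j||e1 IH1 e2 IH2|e1 IH1 e2 IH2] /=.
- rewrite big1 => [|k _]; last by rewrite !mulr0 addr0.
  exact: has_dderiv_cst.
- rewrite (bigD1 j)//= big1 => [|k kj]; last by rewrite eq_sym (negbTE kj) !mulr0 addr0.
  by rewrite eqxx mulr1 mulr0 !addr0; exact: has_dderiv_coord.
- rewrite (bigD1 j)//= big1 => [|k kj]; last by rewrite eq_sym (negbTE kj) !mulr0 addr0.
  rewrite eqxx mulr1 mulr0 addr0 add0r.
  by apply: has_dderiv_conj; exact: has_dderiv_coord.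
- have := has_dderivV (sqnorm_neq0 z0) (@has_dderiv_sqnorm v z).
  congr has_dderiv; rewrite -sumrN big_distrl /=; apply: eq_bigr => k _.
  by field; exact: sqnorm_neq0.
- under eq_bigr do rewrite !mulrDr addrACA.
  by rewrite big_split; exact: (has_dderivD IH1 IH2).
- have := has_dderivM IH1 IH2.
  congr has_dderiv; rewrite mulr_suml mulr_sumr -big_split /=.
  by apply: eq_bigr => k _; ring.
Qed.

Lemma neq0_coord z : z != 0 -> exists j, z 0 j != 0.
Proof.
move=> z0; apply/existsP; apply: contraNT z0; rewrite negb_exists => /forallP zj.
by apply/eqP/rowP => j; rewrite mxE; apply/eqP; have := zj j; rewrite negbK.
Qed.

Lemma coord_neq0 z j : z 0 j != 0 -> z != 0.
Proof. by apply: contra_neq => ->; rewrite mxE. Qed.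

Lemma near_neq0 z : z != 0 -> \forall w \near (z : 'rV[R[i]^o]_n), w != 0.
Proof.
case/neq0_coord => j zj0; have cj := @coord_continuous R[i] 1 n 0 j z.
have nz : \forall w \near (z : 'rV[R[i]^o]_n), ((w : 'rV[R[i]^o]_n) 0 j : R[i]^o) != 0.
  exact: (@cvgr_neq0 _ R[i]^o _ _ _ _ _ cj zj0).
by near=> w; apply: (@coord_neq0 w j); near: w.
Unshelve. all: by end_near. Qed.

(** A directional derivative at z <> 0 only sees the function away from the
    origin, where values are irrelevant. *)
Lemma has_dderiv_off0 f g v z l : z != 0 -> (forall w, w != 0 -> f w = g w) ->
  has_dderiv g v z l -> has_dderiv f v z l.
Proof.
move=> z0 fg.
have [j zj0] := neq0_coord z0.
have nz : \forall s \near 0^', (z + (s : R)%:C%C *: v) 0 j != 0.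
  exact: (@cvgr_neq0 _ R[i]^o _ _ _ _ _ (has_dderiv_cvg (@has_dderiv_coord R n j v z)) zj0).
apply: cvgC_near; near=> s; rewrite /diffquot !fg//.
by apply: (@coord_neq0 _ j); near: s.
Unshelve. all: by end_near. Qed.

Lemma heval_dderiv_delta (t : R[i]) k e z :
  heval (hdderiv (t *: 'e_k) e) z =
  t * heval (hdz k e) z + t^* * heval (hdzbar k e) z.
Proof.
rewrite heval_dderiv (bigD1 k)//= big1 => [|j jk].
  by rewrite !mxE !eqxx mulr1 addr0.
by rewrite !mxE (negbTE jk) /= mulr0 conjC0 !mul0r addr0.
Qed.

(** On the lines through v = e_k and v = i e_k the derivative is d + dbar and
    i (d - dbar), and the combination defining d/dz_k isolates d. *)
Lemma dz_heval f e k z : z != 0 -> (forall w, w != 0 -> f w = heval e w) ->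
  dz k f z = heval (hdz k e) z.
Proof.
move=> z0 fe; have D v := has_dderivE (has_dderiv_off0 (v := v) z0 fe (has_dderiv_heval z0)).
rewrite /dz !D !heval_dderiv_delta -['e_k]scale1r heval_dderiv_delta.
rewrite conjC1 conjCi !mul1r mulrDr !mulrA mulrN -expr2 sqrCi.
by field.
Qed.

Lemma dzbar_heval f e k z : z != 0 -> (forall w, w != 0 -> f w = heval e w) ->
  dzbar k f z = heval (hdzbar k e) z.
Proof.
move=> z0 fe; have D v := has_dderivE (has_dderiv_off0 (v := v) z0 fe (has_dderiv_heval z0)).
rewrite /dzbar !D !heval_dderiv_delta -['e_k]scale1r heval_dderiv_delta.
rewrite conjC1 conjCi !mul1r mulrDr !mulrA mulrN -expr2 sqrCi.
by field.
Qed.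

(** The filter is abstract so that the topology of the source enters only
    through the convergence of the coordinates. *)
Lemma cvg_heval (F : set_system 'rV[R[i]]_n) {FF : Filter F} e z : z != 0 ->
  (forall j, (fun w => w 0 j : R[i]^o) @ F --> (z 0 j : R[i]^o)) ->
  (heval e : _ -> R[i]^o) @ F --> (heval e z : R[i]^o).
Proof.
move=> z0 cc; elim: e => [c|j|j||e1 IH1 e2 IH2|e1 IH1 e2 IH2].
- exact: (cvgC_cst c).
- exact: (cc j).
- exact: (cvgC_conj (cc j)).
- apply: cvgCV; first exact: sqnorm_neq0.
  rewrite (funext sqnormE : sqnorm = _).
  elim: (index_enum _) => [|k r IH].
    by rewrite big_nil; under eq_fun do rewrite big_nil; exact: (cvgC_cst 0).
  rewrite big_cons; under eq_fun do rewrite big_cons.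
  by apply: cvgCD IH; apply: cvgCM; [exact: (cc k)|exact: (cvgC_conj (cc k))].
- exact: (cvgCD IH1 IH2).
- exact: (cvgCM IH1 IH2).
Qed.

Lemma continuous_heval e z : z != 0 ->
  {for z, continuous (heval e : 'rV[R[i]^o]_n -> R[i]^o)}.
Proof.
move=> z0; apply: (@cvg_heval (nbhs (z : 'rV[R[i]^o]_n)) _ e z z0) => j.
exact: (@coord_continuous R[i]).
Qed.

Lemma continuous_off0 f e z : z != 0 -> (forall w, w != 0 -> f w = heval e w) ->
  {for z, continuous (f : 'rV[R[i]^o]_n -> R[i]^o)}.
Proof.
move=> z0 fe; have ce := continuous_heval (e := e) z0.
have nz := near_neq0 z0.
rewrite -[{for z, _}]/((f : 'rV[R[i]^o]_n -> R[i]^o) @ (z : 'rV[R[i]^o]_n) -->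
  (f z : R[i]^o)) fe//.
apply: (@cvgC_near R _ (nbhs (z : 'rV[R[i]^o]_n)) _ (heval e) f _ _ ce).
by near=> w; rewrite fe//; near: w.
Unshelve. all: by end_near. Qed.

(** Induction on the order works because the class is stable under all
    directional derivatives, up to the value at the origin. *)
Lemma smooth_heval f e : (forall w, w != 0 -> f w = heval e w) -> smooth_off0 f.
Proof.
move=> + m; elim: m f e => [|m IH] f e fe.
  by split=> // z z0; exact: continuous_off0 fe.
split=> [z z0|v]; first exact: continuous_off0 fe.
split=> [z z0|].
  exact: has_dderiv_dderivable (has_dderiv_off0 z0 fe (has_dderiv_heval z0)).
apply: (IH _ (hdderiv v e)) => z z0.
exact: has_dderivE (has_dderiv_off0 z0 fe (has_dderiv_heval z0)).
Qed.

End HopfExpressions.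

(** * Contractions with the metric g(alpha, beta) *)

Section Contractions.
Context {K : fieldType} {n : nat} (x y : 'I_n -> K) (r a b : K).
Hypotheses (xyr : \sum_k x k * y k = r) (r0 : r != 0) (a0 : a != 0)
  (ab0 : a + b != 0).

Definition kron (i j : 'I_n) : K := (i == j)%:R.

Lemma kronC i j : kron i j = kron j i.
Proof. by rewrite /kron eq_sym. Qed.

Lemma sum_kron j (f : 'I_n -> K) : \sum_k kron k j * f k = f j.
Proof.
rewrite (bigD1 j)//= /kron eqxx mul1r big1 ?addr0// => k kj.
by rewrite (negbTE kj) mul0r.
Qed.

(** By the Sherman-Morrison formula, a rank-one perturbation of a multiple of
    the identity. *)
Definition inv_metric k l : K := r / a * (kron k l - b / (a + b) * (x k * y l) / r).
Local Notation G := inv_metric.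

(** g(alpha, beta) with x = z, y = conj z, r = |z|^2, a = alpha, b = beta. *)
Definition metric i j : K := a * (kron i j / r) + b * (y i * x j / r ^+ 2).

Lemma metric_inv_metric i k : \sum_l metric i l * inv_metric k l = kron i k.
Proof.
rewrite /metric /inv_metric.
transitivity (\sum_l (kron l i * (kron k l - b / (a + b) * (x k * y l) / r)
   + kron l k * (b / a * y i * x l / r)
   + (x l * y l) * (- b / a * y i * (b / (a + b)) * x k / r ^+ 2))).
  by apply: eq_bigr => l _; rewrite (kronC i l) (kronC k l); field; rewrite r0 a0 ab0.
rewrite !big_split /= !sum_kron -mulr_suml xyr (kronC k i).
by field; rewrite r0 a0 ab0.
Qed.

(** The radial direction is an eigenvector of the metric: there the inverse
    metric is r / (a + b) instead of r / a. *)
Lemma inv_metric_y l : \sum_k inv_metric k l * y k = r / (a + b) * y l.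
Proof.
rewrite /inv_metric.
transitivity (\sum_k (kron k l * (r / a * y k)
   + x k * y k * (- (b / (a + b)) / a * y l))).
  by apply: eq_bigr => k _; field; rewrite r0 a0 ab0.
rewrite big_split /= sum_kron -mulr_suml xyr.
by field; rewrite a0 ab0.
Qed.

Lemma inv_metric_x k : \sum_l inv_metric k l * x l = r / (a + b) * x k.
Proof.
rewrite /inv_metric.
transitivity (\sum_l (kron l k * (r / a * x l)
   + x l * y l * (- (b / (a + b)) / a * x k))).
  by apply: eq_bigr => l _; rewrite (kronC k l); field; rewrite r0 a0 ab0.
rewrite big_split /= sum_kron -mulr_suml xyr.
by field; rewrite a0 ab0.
Qed.

Lemma inv_metric_tr : \sum_k inv_metric k k = r / a * (n%:R - b / (a + b)).
Proof.
rewrite /inv_metric.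
transitivity (\sum_k (r / a + x k * y k * (- (b / (a + b)) / a))).
  by apply: eq_bigr => k _; rewrite /kron eqxx mulr1n; field; rewrite r0 a0 ab0.
rewrite big_split /= -[X in _ + X]mulr_suml xyr sumr_const card_ord -mulr_natr.
by field; rewrite a0 ab0.
Qed.

Definition contr (f : 'I_n -> 'I_n -> K) : K := \sum_k \sum_l G k l * f k l.

Lemma contr_ext (f f' : 'I_n -> 'I_n -> K) :
  (forall k l, f k l = f' k l) -> contr f = contr f'.
Proof.
by move=> ff'; apply: eq_bigr => k _; apply: eq_bigr => l _; rewrite ff'.
Qed.

Lemma contrD f g : contr (fun k l => f k l + g k l) = contr f + contr g.
Proof.
rewrite -big_split; apply: eq_bigr => k _; rewrite -big_split.
by apply: eq_bigr => l _; rewrite mulrDr.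
Qed.

Lemma contrZ c f : contr (fun k l => c * f k l) = c * contr f.
Proof.
rewrite mulr_sumr; apply: eq_bigr => k _; rewrite mulr_sumr.
by apply: eq_bigr => l _; rewrite mulrCA.
Qed.

Lemma contr_sum (I : Type) (s : seq I) (f : I -> 'I_n -> 'I_n -> K) :
  contr (fun k l => \sum_(p <- s) f p k l) = \sum_(p <- s) contr (f p).
Proof.
elim: s => [|p s IH].
  rewrite big_nil /contr big1// => k _; rewrite big1// => l _.
  by rewrite big_nil mulr0.
rewrite big_cons -IH -contrD.
by apply: contr_ext => k l; rewrite big_cons.
Qed.

Lemma contr_kron j i : contr (fun k l => kron k j * kron l i) = G j i.
Proof.
rewrite -[RHS](sum_kron j (fun k => G k i)); apply: eq_bigr => k _.
rewrite -[X in kron k j * X](sum_kron i) mulr_sumr.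
by apply: eq_bigr => l _; ring.
Qed.

(** Up to renaming indices, all contractions in S and in the Q^k reduce to
    those of these five tensors, because the inverse metric multiplies x and y
    by r / (a + b). *)
Lemma contr_basis c1 c2 c3 c4 c5 j i :
  contr (fun k l => c1 * (y k * x l) + c2 * (kron k j * x l) + c3 * kron k l
                    + c4 * (kron k j * kron l i) + c5 * (y k * kron l i)) =
  c1 * (r ^+ 2 / (a + b)) + c2 * (r / (a + b) * x j)
  + c3 * (r / a * (n%:R - b / (a + b))) + c4 * G j i
  + c5 * (r / (a + b) * y i).
Proof.
rewrite !contrD !contrZ contr_kron.
congr (_ * _ + _ * _ + _ * _ + _ + _ * _).
- transitivity (\sum_k y k * (r / (a + b) * x k)).
    apply: eq_bigr => k _; rewrite -inv_metric_x mulr_sumr.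
    by apply: eq_bigr => l _; ring.
  transitivity (\sum_k x k * y k * (r / (a + b))).
    by apply: eq_bigr => k _; ring.
  by rewrite -mulr_suml xyr; ring.
- rewrite -[RHS](sum_kron j (fun j => r / (a + b) * x j)).
  apply: eq_bigr => k _; rewrite -inv_metric_x mulr_sumr.
  by apply: eq_bigr => l _; ring.
- rewrite -inv_metric_tr; apply: eq_bigr => k _.
  rewrite -[RHS](sum_kron k (fun l => G k l)); apply: eq_bigr => l _.
  by rewrite kronC mulrC.
- rewrite /contr exchange_big /= -[RHS](sum_kron i (fun i => r / (a + b) * y i)).
  apply: eq_bigr => l _; rewrite -inv_metric_y mulr_sumr.
  by apply: eq_bigr => k _; ring.
Qed.

(** T_{ik pbar} of g(alpha, beta). *)
Definition tor_low i k p : K := (a + b) / r ^+ 2 * (y k * kron i p - y i * kron k p).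
(** T_{jbar lbar m} of g(alpha, beta). *)
Definition tor_low_conj j l m : K := (a + b) / r ^+ 2 * (x l * kron j m - x j * kron l m).

(** The fourfold contraction in the definition of the Q^k. *)
Definition contr2 (f : 'I_n -> 'I_n -> 'I_n -> 'I_n -> K) : K :=
  \sum_k \sum_l \sum_m \sum_p G k l * G m p * f k l m p.

Lemma contr2E f : contr2 f = contr (fun k l => contr (f k l)).
Proof.
apply: eq_bigr => k _; apply: eq_bigr => l _; rewrite mulr_sumr.
apply: eq_bigr => m _; rewrite mulr_sumr; apply: eq_bigr => p _.
by rewrite mulrA.
Qed.

Definition metric_ratio : K := (a + b) / a.

Lemma Q1_contr i j : contr2 (fun k l m p => tor_low i k p * tor_low_conj j l m) =
  (metric_ratio * kron i j + ((n%:R - 1) * metric_ratio ^+ 2 - metric_ratio) * (y i * x j) / r) / r.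
Proof.
rewrite contr2E.
pose s := (a + b) / r ^+ 2.
transitivity (contr (fun k l => s ^+ 2 * (y k * x l * G j i
  - y k * x j * G l i - y i * x l * G j k + y i * x j * G l k))).
  apply: contr_ext => k l.
  transitivity (contr (fun m p =>
     s ^+ 2 * y k * x l * (kron m j * kron p i)
     + - s ^+ 2 * y k * x j * (kron m l * kron p i)
     + - s ^+ 2 * y i * x l * (kron m j * kron p k)
     + s ^+ 2 * y i * x j * (kron m l * kron p k))).
    apply: contr_ext => m p; rewrite /tor_low /tor_low_conj -/s.
    by rewrite (kronC i p) (kronC k p) (kronC j m) (kronC l m); ring.
  by rewrite !contrD !contrZ !contr_kron; ring.
transitivity (contr (fun k l =>
   (s ^+ 2 * (G j i + y i * x j * (b / (a + b) / a))) * (y k * x l)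
   + (- s ^+ 2 * (r / a) * y i) * (kron k j * x l)
   + (s ^+ 2 * (r / a) * y i * x j) * kron k l
   + 0 * (kron k j * kron l i)
   + (- s ^+ 2 * (r / a) * x j) * (y k * kron l i))).
  apply: contr_ext => k l; rewrite /inv_metric (kronC j k) (kronC l k).
  by field; rewrite r0 a0 ab0.
rewrite contr_basis /s /inv_metric /metric_ratio (kronC j i).
by field; rewrite r0 a0 ab0.
Qed.

Lemma Q2_contr i j : contr2 (fun k l m p => tor_low k m j * tor_low_conj l p i) =
  (2 * metric_ratio * kron i j - 2 * metric_ratio * (y i * x j) / r) / r.
Proof.
rewrite contr2E.
pose s := (a + b) / r ^+ 2.
transitivity (contr (fun k l => s ^+ 2 * G j i * (y k * x l)
   + (- s ^+ 2 * (r / (a + b) * y i)) * (kron k j * x l) + 0 * kron k l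
   + (s ^+ 2 * (r ^+ 2 / (a + b))) * (kron k j * kron l i)
   + (- s ^+ 2 * (r / (a + b) * x j)) * (y k * kron l i))).
  apply: contr_ext => k l.
  transitivity (contr (fun m p =>
     (s ^+ 2 * kron k j * kron l i) * (y m * x p)
     + (- s ^+ 2 * y k * kron l i) * (kron m j * x p) + 0 * kron m p
     + (s ^+ 2 * y k * x l) * (kron m j * kron p i)
     + (- s ^+ 2 * kron k j * x l) * (y m * kron p i))).
    by apply: contr_ext => m p; rewrite /tor_low /tor_low_conj -/s; ring.
  by rewrite contr_basis; ring.
rewrite contr_basis /s /inv_metric /metric_ratio (kronC j i).
by field; rewrite r0 a0 ab0.
Qed.

Lemma Q3_contr i j : contr2 (fun k l m p => tor_low i k l * tor_low_conj j p m) =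
  ((n%:R - 1) ^+ 2 * metric_ratio ^+ 2 * (y i * x j) / r) / r.
Proof.
rewrite contr2E.
pose s := (a + b) / r ^+ 2.
(* the trace of the conjugate torsion *)
pose t := s * (1 - n%:R) * (r / a) * x j.
transitivity (contr (fun k l => 0 * (y k * x l) + 0 * (kron k j * x l)
   + (- t * s * y i) * kron k l + 0 * (kron k j * kron l i)
   + (t * s) * (y k * kron l i))).
  apply: contr_ext => k l.
  transitivity (contr (fun m p => 0 * (y m * x p)
     + (tor_low i k l * s) * (kron m j * x p)
     + (- tor_low i k l * s * x j) * kron m p
     + 0 * (kron m j * kron p i) + 0 * (y m * kron p i))).
    by apply: contr_ext => m p; rewrite /tor_low_conj -/s (kronC j m) (kronC p m); ring.
  rewrite contr_basis /tor_low -/s (kronC i l) /t.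
  by field; rewrite a0 ab0.
rewrite contr_basis /t /s /metric_ratio.
by field; rewrite r0 a0 ab0.
Qed.

Lemma Q4_contr i j :
  contr2 (fun k l m p => tor_low m k l * tor_low_conj p j i + tor_low m i j * tor_low_conj p l k) =
  2 * ((n%:R - 1) * metric_ratio * kron i j - (n%:R - 1) * metric_ratio * (y i * x j) / r) / r.
Proof.
rewrite contr2E.
pose s := (a + b) / r ^+ 2.
pose e := r / (a + b).
transitivity (contr (fun k l => s ^+ 2 * ((y k * x j * G l i
   - y k * kron j i * (e * x l) - x j * kron k l * (e * y i)
   + kron k l * kron j i * (e * r))
   + (y i * x l * G j k - y i * kron k l * (e * x j)
   - kron i j * x l * (e * y k) + kron i j * kron k l * (e * r))))).
  apply: contr_ext => k l; rewrite contrD.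
  transitivity (contr (fun m p =>
     (s ^+ 2 * kron k l * kron j i) * (y m * x p)
     + (- s ^+ 2 * y k * kron j i) * (kron m l * x p) + 0 * kron m p
     + (s ^+ 2 * y k * x j) * (kron m l * kron p i)
     + (- s ^+ 2 * kron k l * x j) * (y m * kron p i))
   + contr (fun m p =>
     (s ^+ 2 * kron k l * kron i j) * (y m * x p)
     + (- s ^+ 2 * y i * kron k l) * (kron m j * x p) + 0 * kron m p
     + (s ^+ 2 * y i * x l) * (kron m j * kron p k)
     + (- s ^+ 2 * kron i j * x l) * (y m * kron p k))).
    congr (_ + _); apply: contr_ext => m p; rewrite /tor_low /tor_low_conj -/s ?(kronC l k); ring.
  by rewrite !contr_basis -!/e -(_ : e * r = r ^+ 2 / (a + b)); [ring|rewrite /e; ring].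
transitivity (contr (fun k l => 
   (s ^+ 2 * (- y i * x j * (b / (a + b)) / a - kron j i * e 
              - y i * x j * (b / (a + b)) / a - kron j i * e)) * (y k * x l)
   + (s ^+ 2 * (r / a) * y i) * (kron k j * x l)
   + (s ^+ 2 * (- x j * e * y i + kron j i * e * r - y i * e * x j + kron j i * e * r)) * kron k l
   + 0 * (kron k j * kron l i)
   + (s ^+ 2 * (r / a) * x j) * (y k * kron l i))).
  apply: contr_ext => k l; rewrite /inv_metric (kronC i j) (kronC j k).
  by field; rewrite r0 a0 ab0.
rewrite contr_basis /s /e /metric_ratio (kronC j i).
by field; rewrite r0 a0 ab0.
Qed.

(** Gamma_{ik}^p of g(alpha, beta).  No denominator a + b survives, so it is a
    polynomial in conj z_i, z_p and 1 / |z|^2. *)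
Definition christoffel i k p : K :=
  (b / a * y k * kron i p - y i * kron k p - b / a * (y i * y k * x p) / r) / r.

(** The derivative of [christoffel k i p] with respect to conj z_l. *)
Definition dbar_christoffel l k i p : K :=
  - x l / r ^+ 2 * (b / a * y i * kron k p - y k * kron i p)
  + (b / a * kron l i * kron k p - kron k l * kron i p) / r
  - b / a * (kron k l * y i + y k * kron l i) * x p / r ^+ 2
  + 2 * (b / a) * y k * y i * x p * x l / r ^+ 3.

(** D is d/dz_i of the row k of the metric. *)
Lemma christoffel_contr i k p (D : 'I_n -> K) :
  (forall q, D q = - a * kron k q * y i / r ^+ 2
     + b * (y k * kron q i) / r ^+ 2 - 2 * b * y k * x q * y i / r ^+ 3) ->
  \sum_q G p q * D q = christoffel i k p.
Proof.
move=> DE.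
transitivity (\sum_q (kron q k * (- a * y i / r ^+ 2 * G p q)
   + kron q i * (b * y k / r ^+ 2 * G p q)
   + G p q * x q * (- 2 * b * y k * y i / r ^+ 3))).
  by apply: eq_bigr => q _; rewrite DE (kronC k q); ring.
rewrite !big_split /= !sum_kron -mulr_suml inv_metric_x /christoffel /inv_metric.
by rewrite (kronC k p) (kronC i p); field; rewrite r0 a0 ab0.
Qed.

(** Radial directions do not contribute: contracting the curvature with the
    correction term of the inverse metric gives 0. *)
Lemma S_contr i j :
  contr (fun k l => \sum_p - dbar_christoffel l k i p * metric p j) =
  ((n%:R - metric_ratio) * kron i j
   + ((2 * n%:R - 1) * (metric_ratio - 1) + (n%:R - 1) * (metric_ratio - 1) ^+ 2) * (y i * x j) / r) / r.
Proof.
transitivity (\sum_p - contr (fun k l => dbar_christoffel l k i p) * metric p j).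
  rewrite contr_sum; apply: eq_bigr => p _; 
  transitivity (- metric p j * contr (fun k l => dbar_christoffel l k i p)); last by ring.
  rewrite -contrZ; by apply: contr_ext => k l; ring.
transitivity (\sum_p (kron p i * ((n%:R - metric_ratio) / a * metric p j)
   + x p * metric p j * (n%:R * b / a ^+ 2 * y i / r))).
  apply: eq_bigr => p _.
  rewrite (contr_ext (f' := fun k l => (b / a * (x p * y i) / r ^+ 3 * 2 + kron i p / r ^+ 2) * (y k * x l)
    + (- (b / a) * y i / r ^+ 2) * (kron k p * x l)
    + (- kron i p / r - b / a * y i * x p / r ^+ 2) * kron k l
    + (b / a / r) * (kron k p * kron l i)
    + (- (b / a) * x p / r ^+ 2) * (y k * kron l i))); last first.
    by move=> k l; rewrite /dbar_christoffel; ring.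
  rewrite contr_basis /inv_metric /metric_ratio (kronC p i).
  by field; rewrite r0 a0 ab0.
rewrite big_split /= sum_kron -mulr_suml.
rewrite (_ : \sum_p x p * metric p j = (a + b) / r * x j); last first.
  transitivity (\sum_p (kron p j * (a / r * x p) + x p * y p * (b * x j / r ^+ 2))).
    by apply: eq_bigr => p _; rewrite /metric; ring.
  by rewrite big_split /= sum_kron -mulr_suml xyr; field.
by rewrite /metric /metric_ratio; field; rewrite r0 a0.
Qed.

End Contractions.

(** * The right-hand side of the flow on g(alpha, beta) *)

Section HopfTensors.
Context {R : realType} {n : nat} (alpha beta : R).
Hypotheses (alpha0 : alpha != 0) (tau0 : alpha + beta != 0).
Implicit Types z w : 'rV[R[i]]_n.
Local Notation g := (@hopf_metric R n alpha beta).
Local Notation al := alpha%:C%C.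
Local Notation be := beta%:C%C.
Local Notation xx z := (fun k => z 0 k).
Local Notation yy z := (fun k => (z 0 k)^*).

Let al0 : al != 0. Proof. by rewrite fmorph_eq0. Qed.
Let albe0 : al + be != 0. Proof. by rewrite -rmorphD fmorph_eq0. Qed.
Let xyr z : \sum_k z 0 k * (z 0 k)^* = sqnorm z. Proof. by rewrite sqnormE. Qed.

Lemma hopf_metricE z i j : g z i j = metric (xx z) (yy z) (sqnorm z) al be i j.
Proof. by rewrite mxE. Qed.

Definition hmetric i j : @hexpr R n :=
  HAdd (HMul (HCst al) (HMul (HCst (kron i j)) HInv))
       (HMul (HCst be) (HMul (HMul (HZbar i) (HZ j)) (HMul HInv HInv))).

Lemma heval_hmetric i j z : g z i j = heval (hmetric i j) z.
Proof. by rewrite hopf_metricE /= /metric expr2 invfM. Qed.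

Lemma ginv_hopf z k l : z != 0 ->
  ginv g z k l = inv_metric (xx z) (yy z) (sqnorm z) al be k l.
Proof.
move=> /sqnorm_neq0 r0; rewrite /ginv.
pose G := \matrix_(l, k) inv_metric (xx z) (yy z) (sqnorm z) al be k l.
have gG : g z *m G = 1%:M.
  apply/matrixP => i m; rewrite !mxE.
  under eq_bigr do rewrite hopf_metricE mxE.
  by rewrite metric_inv_metric.
have [gu _] := mulmx1_unit gG.
by rewrite -[invmx _]mulmx1 -gG mulKmx// mxE.
Qed.

Lemma Gamma_hopf z i k p : z != 0 ->
  Gamma g i k p z = christoffel (xx z) (yy z) (sqnorm z) al be i k p.
Proof.
move=> z0; have r0 := sqnorm_neq0 z0; rewrite /Gamma.
under eq_bigr do rewrite ginv_hopf//.
apply: christoffel_contr => // q.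
rewrite (dz_heval (e := hmetric k q))//; last by move=> w _; exact: heval_hmetric.
rewrite /= -/(kron q i); field.
exact: r0.
Qed.

Definition hchristoffel i k p : @hexpr R n :=
  HAdd (HMul (HAdd (HMul (HCst (be / al * kron i p)) (HZbar k))
                   (HMul (HCst (- kron k p)) (HZbar i))) HInv)
       (HMul (HCst (- (be / al))) (HMul (HMul (HZbar i) (HMul (HZbar k) (HZ p)))
            (HMul HInv HInv))).

Lemma heval_hchristoffel i k p z : z != 0 -> Gamma g i k p z = heval (hchristoffel i k p) z.
Proof.
move=> z0; have r0 := sqnorm_neq0 z0; rewrite Gamma_hopf//= /christoffel.
by field; rewrite al0 r0.
Qed.

Lemma dzbar_Gamma_hopf z l k i p : z != 0 ->
  dzbar l (Gamma g k i p) z = dbar_christoffel (xx z) (yy z) (sqnorm z) al be l k i p.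
Proof.
move=> z0; have r0 := sqnorm_neq0 z0.
rewrite (dzbar_heval (e := hchristoffel k i p))//; last by move=> w; exact: heval_hchristoffel.
rewrite /= -/(kron k l) -/(kron i l) /dbar_christoffel (kronC l i).
by field; rewrite al0 r0.
Qed.

Lemma tors_hopf z i k p : z != 0 ->
  tors g z i k p = tor_low (yy z) (sqnorm z) al be i k p.
Proof.
move=> z0; have r0 := sqnorm_neq0 z0; rewrite /tors /torsion.
set x := (fun k => z 0 k); set y := (fun k => (z 0 k)^*); set r := sqnorm z.
transitivity (\sum_q (kron q i * (metric_ratio al be * y k / r * metric x y r al be q p)
   + kron q k * (- metric_ratio al be * y i / r * metric x y r al be q p))).
  apply: eq_bigr => q _; rewrite hopf_metricE !Gamma_hopf// -/x -/y -/r.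
  rewrite /christoffel /metric_ratio (kronC i q) (kronC k q); field.
  by rewrite r0 al0.
rewrite big_split /= !sum_kron /metric /metric_ratio /tor_low.
by field; rewrite r0 al0.
Qed.

Lemma torsbar_hopf z j l m : z != 0 ->
  torsbar g z j l m = tor_low_conj (xx z) (sqnorm z) al be j l m.
Proof.
move=> z0; rewrite /torsbar tors_hopf// /tor_low /tor_low_conj.
rewrite !(rmorphM, rmorphB, rmorphD, fmorphV, rmorphXn) /= !conjCK /kron !conjC_nat.
have -> : (sqnorm z)^* = sqnorm z.
  by rewrite /sqnorm rmorph_sum; apply: eq_bigr => k _; rewrite rmorphXn /= conj_normC.
by rewrite !conj_Creal// complex_real.
Qed.

End HopfTensors.

(** The coefficient of u in alpha'. *)
Definition coefP {R : realType} (n : nat) (a b d : R) : R :=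
  1 + a + 2 * b + (n%:R - 1) * d.
(** The coefficient of u^2 in tau'. *)
Definition coefQ {R : realType} (n : nat) (a c : R) : R :=
  (n%:R - 1) * (a + (n%:R - 1) * c - 1).

(** The flow is tangent to the family; in terms of alpha and tau = alpha +
    beta its velocity only depends on the ratio u, since S and the Q^k do not
    change when the metric is rescaled. *)
Lemma hcf_rhs_hopf {R : realType} {n : nat} (a b c d alpha beta : R)
    (z : 'rV[R[i]]_n) :
  alpha != 0 -> alpha + beta != 0 -> z != 0 ->
  let u := (alpha + beta) / alpha in
  let adot := - n%:R + coefP n a b d * u in
  let taudot := coefQ n a c * u ^+ 2 in
  hcf_rhs a b c d (hopf_metric alpha beta) z = hopf_metric adot (taudot - adot) z.
Proof.
set g := hopf_metric alpha beta.
move=> alpha0 tau0 z0 u adot taudot; have r0 := sqnorm_neq0 z0; have xyr := esym (sqnormE z).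
have al0 : alpha%:C%C != 0 :> R[i] by rewrite fmorph_eq0.
have albe0 : alpha%:C%C + beta%:C%C != 0 :> R[i].
  by rewrite -rmorphD fmorph_eq0.
apply/matrixP => i j.
have S_ := S_contr xyr r0 al0 albe0 i j.
rewrite [LHS](_ : _ = Sric g z i j) in S_; last first.
  rewrite mxE; apply: eq_bigr => k _; apply: eq_bigr => l _.
  rewrite ginv_hopf//; congr (_ * _); apply: eq_bigr => p _.
  by rewrite dzbar_Gamma_hopf// hopf_metricE.
have Q1_ := Q1_contr xyr r0 al0 albe0 i j.
rewrite [LHS](_ : _ = Q1 g z i j) in Q1_; last first.
  rewrite mxE; apply: eq_bigr => k _; apply: eq_bigr => l _.
  apply: eq_bigr => m _; apply: eq_bigr => p _.
  by rewrite !ginv_hopf// tors_hopf// torsbar_hopf.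
have Q2_ := Q2_contr xyr r0 al0 albe0 i j.
rewrite [LHS](_ : _ = Q2 g z i j) in Q2_; last first.
  rewrite mxE; apply: eq_bigr => k _; apply: eq_bigr => l _.
  apply: eq_bigr => m _; apply: eq_bigr => p _.
  by rewrite !ginv_hopf// tors_hopf// torsbar_hopf.
have Q3_ := Q3_contr xyr r0 al0 albe0 i j.
rewrite [LHS](_ : _ = Q3 g z i j) in Q3_; last first.
  rewrite mxE; apply: eq_bigr => k _; apply: eq_bigr => l _.
  apply: eq_bigr => m _; apply: eq_bigr => p _.
  by rewrite !ginv_hopf// tors_hopf// torsbar_hopf.
have Q4_ := Q4_contr xyr r0 al0 albe0 i j.
rewrite [LHS](_ : _ = 2 * Q4 g z i j) in Q4_; last first.
  rewrite mxE mulrA mulfV ?pnatr_eq0// mul1r.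
  apply: eq_bigr => k _; apply: eq_bigr => l _.
  apply: eq_bigr => m _; apply: eq_bigr => p _.
  by rewrite !ginv_hopf// !tors_hopf// !torsbar_hopf.
have {}Q4_ := canRL (mulKf (_ : 2 != 0 :> R[i])) Q4_.
rewrite [RHS]hopf_metricE /hcf_rhs.
move: (Sric g z) (Q1 g z) (Q2 g z) (Q3 g z) (Q4 g z) S_ Q1_ Q2_ Q3_ Q4_.
move=> S M1 M2 M3 M4 S_ Q1_ Q2_ Q3_ Q4_.
rewrite !mxE S_ Q1_ Q2_ Q3_ Q4_ ?pnatr_eq0//.
rewrite /metric /taudot /adot /u /coefP /coefQ /metric_ratio.
by field; apply/andP; split.
Qed.

(** * The metrics g(alpha, beta) on the Hopf manifold *)

Section HopfHermitian.
Context {R : realType} {n : nat}.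
Implicit Types (mu z v : 'rV[R[i]]_n) (alpha beta : R).

Lemma sqnorm_ge0 z : 0 <= sqnorm z.
Proof. by apply: sumr_ge0 => k _; rewrite exprn_ge0. Qed.

Lemma sqnorm_gt0 z : z != 0 -> 0 < sqnorm z.
Proof. by move=> z0; rewrite lt_def sqnorm_neq0// sqnorm_ge0. Qed.

Lemma conj_sqnorm z : (sqnorm z)^* = sqnorm z.
Proof. by rewrite conj_Creal// ger0_real// sqnorm_ge0. Qed.

Lemma conj_real (x : R) : (x%:C%C : R[i])^* = x%:C%C.
Proof. by rewrite conj_Creal// complex_real. Qed.

(** This is where the multipliers need a common modulus. *)
Lemma sqnorm_deck mu z rho : (forall i, `|mu 0 i| = rho) ->
  sqnorm (deck mu z) = rho ^+ 2 * sqnorm z.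
Proof.
move=> muE; rewrite /sqnorm mulr_sumr; apply: eq_bigr => k _.
by rewrite mxE normrM muE exprMn.
Qed.

(** Splitting v into its component along z and the orthogonal remainder
    diagonalizes the metric, with eigenvalues alpha and alpha + beta up to the
    factor 1 / |z|^2. *)
Lemma hopf_metric_form alpha beta z v : z != 0 ->
  let c := \sum_k v 0 k * (z 0 k)^* in
  \sum_i \sum_j hopf_metric alpha beta z i j * v 0 i * (v 0 j)^* =
  alpha%:C%C * sqnorm (v - (c / sqnorm z) *: z) / sqnorm z
  + (alpha + beta)%:C%C * `|c| ^+ 2 / sqnorm z ^+ 2.
Proof.
move=> z0 c; have r0 := sqnorm_neq0 z0; set r := sqnorm z in r0 *.
have cE : c^* = \sum_k z 0 k * (v 0 k)^*.
  rewrite rmorph_sum; apply: eq_bigr => k _.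
  by rewrite rmorphM /= conjCK mulrC.
transitivity (\sum_i (v 0 i * (v 0 i)^* * (alpha%:C%C / r)
   + v 0 i * (z 0 i)^* * (beta%:C%C * c^* / r ^+ 2))).
  apply: eq_bigr => i _.
  transitivity (\sum_j (kron j i * (alpha%:C%C / r * v 0 i * (v 0 j)^*)
     + z 0 j * (v 0 j)^* * (beta%:C%C * v 0 i * (z 0 i)^* / r ^+ 2))).
    apply: eq_bigr => j _; rewrite hopf_metricE /metric -/r (kronC i j).
    by field.
  by rewrite big_split /= sum_kron -mulr_suml -cE; ring.
rewrite big_split /= -!mulr_suml -sqnormE -/c.
(* Pythagoras *)
rewrite (_ : sqnorm (v - _) = sqnorm v - c * c^* / r); last first.
  rewrite [LHS]sqnormE.
  transitivity (\sum_k (v 0 k * (v 0 k)^* + v 0 k * (z 0 k)^* * (- c^* / r)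
     + z 0 k * (v 0 k)^* * (- c / r) + z 0 k * (z 0 k)^* * (c * c^* / r ^+ 2))).
    apply: eq_bigr => k _; rewrite !mxE rmorphB !rmorphM /= fmorphV /= conj_sqnorm.
    by rewrite -/r; field.
  rewrite !big_split /= -!mulr_suml -!sqnormE -/c -cE -/r.
  by field.
by rewrite normCK rmorphD /=; field.
Qed.

Lemma hopf_metric_hermitian mu alpha beta : hopf_multiplier mu ->
  0 < alpha -> - alpha < beta -> hermitian_metric mu (hopf_metric alpha beta).
Proof.
move=> [mu0 mu_eq _] alpha0; rewrite -subr_gt0 opprK addrC => tau0; split.
- by move=> i j; apply: (smooth_heval (e := hmetric alpha beta i j)) => w _;
    exact: heval_hmetric.
- move=> z z0; apply/is_hermitianmxP/matrixP => i j.
  rewrite expr0 scale1r [RHS]mxE [in RHS]mxE !hopf_metricE /metric.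
  rewrite rmorphD !rmorphM /= !fmorphV !rmorphXn /= !conj_real !conj_sqnorm.
  by rewrite conjCK /kron conjC_nat eq_sym (mulrC (z 0 j)).
- move=> z v z0 v0; rewrite hopf_metric_form//.
  set c := \sum_k _; have r0 := sqnorm_gt0 z0.
  have [c0|c0] := eqVneq c 0.
    rewrite c0 mul0r scale0r subr0 normr0 expr0n mulr0 mul0r addr0.
    by rewrite divr_gt0// mulr_gt0 ?ltcR ?sqnorm_gt0.
  rewrite ltr_wpDl//.
    by rewrite divr_ge0 ?sqnorm_ge0// mulr_ge0 ?sqnorm_ge0// lecR ltW.
  by rewrite divr_gt0 ?exprn_gt0// mulr_gt0 ?ltcR// exprn_gt0// normr_gt0.
- move=> z i j z0; have r0 := sqnorm_neq0 z0.
  have [k muk0] := neq0_coord mu0.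
  have rho0 : `|mu 0 k| != 0 by rewrite normr_eq0.
  have muE l : `|mu 0 l| = `|mu 0 k| by [].
  rewrite !hopf_metricE /metric (sqnorm_deck _ muE) !mxE rmorphM /=.
  have muM l : mu 0 l * (mu 0 l)^* = `|mu 0 k| ^+ 2 by rewrite -normCK muE.
  transitivity (alpha%:C%C * (kron i j * (mu 0 i * (mu 0 j)^*) / (`|mu 0 k| ^+ 2 * sqnorm z))
    + beta%:C%C * ((mu 0 i * (mu 0 i)^*) * (mu 0 j * (mu 0 j)^*)
       * ((z 0 i)^* * z 0 j) / (`|mu 0 k| ^+ 2 * sqnorm z) ^+ 2)).
    by ring.
  have -> : kron i j * (mu 0 i * (mu 0 j)^*) = kron i j * `|mu 0 k| ^+ 2 :> R[i].
    rewrite /kron; case: eqVneq => [->|_]; first by rewrite muM.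
    by rewrite !mul0r.
  by rewrite !muM; field; rewrite r0 rho0.
Qed.

End HopfHermitian.

(** * Flows inside the family and the system for (alpha, tau) *)

Section ReducedFlow.
Context {R : realType}.

(** The time derivative used for flows on [0, T[: two-sided for t > 0, from
    the right at t = 0. *)
Definition has_deriv_ge0 (f : R -> R) (t l : R) : Prop :=
  (fun s => (s - t)^-1 * (f s - f t)) @ within [set s | 0 <= s] t^' --> l.

(** The flow in the family, for N = n, P = [coefP] and Q = [coefQ]. *)
Definition hopf_ode (N P Q : R) (alpha tau : R -> R) (t : R) : Prop :=
  has_deriv_ge0 alpha t (- N + P * (tau t / alpha t)) /\
  has_deriv_ge0 tau t (Q * (tau t / alpha t) ^+ 2).

Context {n : nat} (mu : 'rV[R[i]]_n) (a b c d : R).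
Hypothesis hmu : hopf_multiplier mu.
Implicit Types (alpha beta : R -> R) (T : \bar R).

Lemma sqnorm_delta (k : 'I_n) : sqnorm ('e_k : 'rV[R[i]]_n) = 1.
Proof.
rewrite /sqnorm (bigD1 k)//= big1 => [|j jk].
  by rewrite mxE !eqxx normr1 expr1n addr0.
by rewrite mxE (negbTE jk) normr0 expr0n.
Qed.

Lemma delta_neq0 (k : 'I_n) : ('e_k : 'rV[R[i]]_n) != 0.
Proof. by apply: (@coord_neq0 _ _ _ k); rewrite mxE !eqxx oner_neq0. Qed.

(** At a unit coordinate vector the diagonal entries of the metric are its
    eigenvalues: tau in the radial direction, alpha in the others. *)
Lemma hopf_metric_delta_same x y (k : 'I_n) :
  hopf_metric x y 'e_k k k = (x + y)%:C%C :> R[i].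
Proof.
rewrite hopf_metricE /metric sqnorm_delta /kron mxE !eqxx conjC1.
by rewrite mulr1n !mul1r expr1n invr1 !mulr1 rmorphD.
Qed.

Lemma hopf_metric_delta_other x y (k j : 'I_n) : j != k ->
  hopf_metric x y 'e_k j j = x%:C%C :> R[i].
Proof.
move=> jk; rewrite hopf_metricE /metric sqnorm_delta /kron mxE !eqxx (negbTE jk).
by rewrite mulr1n conjC0 !mul0r mulr0 addr0 invr1 !mulr1.
Qed.

Let N : R := n%:R.
Let P := coefP n a b d.
Let Q := coefQ n a c.

Lemma hopf_solution_of_ode T alpha beta : (0 < T)%E ->
  (forall t, 0 <= t -> (t%:E < T)%E -> 0 < alpha t /\ - alpha t < beta t) ->
  (forall t, 0 <= t -> (t%:E < T)%E ->
     hopf_ode N P Q alpha (fun t => alpha t + beta t) t) ->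
  hcf_solution mu a b c d T (fun t => hopf_metric (alpha t) (beta t)).
Proof.
move=> T0 pos ode; split=> // t t0 tT; have [al0 be0] := pos t t0 tT.
have [dal dtau] := ode t t0 tT.
have tau0 : 0 < alpha t + beta t by rewrite -(opprK (alpha t)) addrC subr_gt0.
split; first exact: hopf_metric_hermitian.
move=> z i j z0.
pose A : R := - N + P * ((alpha t + beta t) / alpha t).
pose B : R := Q * ((alpha t + beta t) / alpha t) ^+ 2.
have hE : hcf_rhs a b c d (hopf_metric (alpha t) (beta t)) z =
    hopf_metric A (B - A) z by apply: hcf_rhs_hopf; rewrite ?gt_eqF.
rewrite hE; have {}dal : has_deriv_ge0 alpha t A := dal.
have {}dtau : has_deriv_ge0 (fun t => alpha t + beta t) t B := dtau.
clearbody A B; clear hE.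
rewrite [X in _ --> X]hopf_metricE /metric.
set r := sqnorm z; set w : R[i] := _ / r ^+ 2.
have -> : A%:C%C * (kron i j / r) + (B - A)%:C%C * w =
    A%:C%C * (kron i j / r - w) + B%:C%C * w by ring.
apply: (cvgC_near _ (cvgCD (cvgCM ((cvg_real_complex _ _).1 dal) (cvgC_cst (kron i j / r - w)))
  (cvgCM ((cvg_real_complex _ _).1 dtau) (cvgC_cst w)))).
by near=> s; rewrite !hopf_metricE /metric -/r -/w; ring.
Unshelve. all: by end_near. Qed.

Lemma hopf_ode_of_solution T alpha beta : (1 < n)%N ->
  (forall t, 0 <= t -> (t%:E < T)%E -> 0 < alpha t /\ - alpha t < beta t) ->
  hcf_solution mu a b c d T (fun t => hopf_metric (alpha t) (beta t)) ->
  forall t, 0 <= t -> (t%:E < T)%E ->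
     hopf_ode N P Q alpha (fun t => alpha t + beta t) t.
Proof.
move=> n1 pos [_ sol] t t0 tT; have [al0 be0] := pos t t0 tT.
have tau0 : 0 < alpha t + beta t by rewrite -(opprK (alpha t)) addrC subr_gt0.
have [_ {}sol] := sol t t0 tT.
pose i0 : 'I_n := Ordinal (ltnW n1); pose i1 : 'I_n := Ordinal n1.
have z0 := delta_neq0 i0.
pose A : R := - N + P * ((alpha t + beta t) / alpha t).
pose B : R := Q * ((alpha t + beta t) / alpha t) ^+ 2.
have hE : hcf_rhs a b c d (hopf_metric (alpha t) (beta t)) 'e_i0 =
    hopf_metric A (B - A) 'e_i0 by apply: hcf_rhs_hopf; rewrite ?gt_eqF.
rewrite -[hopf_ode _ _ _ _ _ _]/(has_deriv_ge0 alpha t A /\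
  has_deriv_ge0 (fun t => alpha t + beta t) t B).
(* At z = e_0 the entry (0, 0) is tau and the entry (1, 1) is alpha. *)
have := sol _ i0 i0 z0; have := sol _ i1 i1 z0; rewrite hE.
clearbody A B; have i10 : i1 != i0 by [].
rewrite !(fun x y => hopf_metric_delta_other x y i10) !hopf_metric_delta_same.
rewrite subrKC => dal dtau.
split; apply: (cvg_real_complex _ _).2.
- apply: (cvgC_near _ dal); near=> s.
  by rewrite !hopf_metric_delta_other//; ring.
- apply: (cvgC_near _ dtau); near=> s.
  by rewrite !hopf_metric_delta_same; ring.
Unshelve. all: by end_near. Qed.

Lemma at_left_within_ge0 (r : R) : 0 < r -> r^'- --> within [set s | 0 <= s] r^'.
Proof.
move=> r0 X nX.
have {}nX : \forall s \near r, s != r -> 0 <= s -> X s := nX.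
suff : \forall s \near r, s < r -> X s by [].
near=> s => sr; have s0 : 0 < s by near: s; exact: (@cvgr_gt _ _ _ _ id r cvg_id 0 r0).
have : s != r -> 0 <= s -> X s by near: s.
by apply; [rewrite lt_eqF|exact: ltW].
Unshelve. all: by end_near. Qed.

(** A metric is positive definite at time r as well, and a solution is
    continuous in time; so no diagonal entry can tend to 0. *)
Lemma extension_bounded_below (r : R) T' (g' : R -> 'rV[R[i]]_n -> 'M[R[i]]_n)
    (z : 'rV[R[i]]_n) (i : 'I_n) (f : R -> R) :
  0 < r -> (r%:E < T')%E -> hcf_solution mu a b c d T' g' -> z != 0 ->
  (forall s, 0 <= s -> s < r -> g' s z i i = (f s)%:C%C) ->
  exists2 e : R, 0 < e & \forall s \near r^'-, e < f s.
Proof.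
move=> r0 rT' [_ /(_ r (ltW r0) rT')[[_ _ posg _] /(_ z i i)]] + z0 gf.
move=> /(_ z0); set L := hcf_rhs _ _ _ _ _ _ _ _ => dg.
have : 0 < g' r z i i.
  have := posg z 'e_i z0 (delta_neq0 i).
  rewrite (bigD1 i)//= [X in _ + X]big1 => [|k ki]; last first.
    by rewrite big1// => j _; rewrite mxE (negbTE ki) /= mulr0 mul0r.
  rewrite (bigD1 i)//= big1 => [|j ji]; last first.
    by rewrite [X in _ * X^*]mxE (negbTE ji) /= conjC0 mulr0.
  by rewrite mxE !eqxx conjC1 !mulr1 !addr0.
case/gt0_complex_real => l l0 lE.
have fl : f s @[s --> r^'-] --> l.
  apply: (cvg_real_complex _ _).2.
  have dg' : (fun s : R => ((s - r)^-1)%:C%C * (g' s z i i - g' r z i i) : R[i]^o) @ r^'-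
      --> (L : R[i]^o) by apply: cvg_trans dg; apply: cvg_app; exact: at_left_within_ge0.
  have sr : (fun s : R => (s - r)%:C%C : R[i]^o) @ r^'- --> (0 : R[i]^o).
    apply/(@cvg_real_complex R R r^'- _ (fun s => s - r) 0)/cvg_at_left_filter.
    by rewrite -(subrr r); apply: cvgB; [exact: cvg_id|exact: cvg_cst].
  rewrite -[l%:C%C]add0r -(mul0r L).
  apply: (cvgC_near _ (cvgCD (cvgCM sr dg') (cvgC_cst (l%:C%C)))).
  near=> s.
  have s0 : 0 <= s by near: s; exact: nbhs_left_ge.
  have sr' : s < r by near: s; exact: nbhs_left_lt.
  rewrite mulrA -rmorphM /= mulfV ?subr_eq0 ?lt_eqF// mul1r gf// lE.
  by rewrite subrK.
exists (l / 2); first by rewrite divr_gt0.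
by apply: (cvgr_gt _ fl); lra.
Unshelve. all: by end_near. Qed.

End ReducedFlow.

(** * Uniqueness for the system *)

Section OneSidedCalculus.
Context {R : realType}.
Implicit Types (f g : R -> R) (t b l : R).

Lemma dnbhs_within_ge0 t : 0 < t -> t^' --> within [set s | 0 <= s] t^'.
Proof.
move=> t0 X nX.
have {}nX : \forall s \near t, s != t -> 0 <= s -> X s := nX.
suff : \forall s \near t, s != t -> X s by [].
near=> s => st; have s0 : 0 < s by near: s; exact: (@cvgr_gt _ _ _ _ id t cvg_id 0 t0).
have : s != t -> 0 <= s -> X s by near: s.
by apply => //; exact: ltW.
Unshelve. all: by end_near. Qed.

Lemma at_right_within_ge0 t : 0 <= t -> t^'+ --> within [set s | 0 <= s] t^'.
Proof.
move=> t0 X nX.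
have {}nX : \forall s \near t, s != t -> 0 <= s -> X s := nX.
suff : \forall s \near t, t < s -> X s by [].
near=> s => ts; have : s != t -> 0 <= s -> X s by near: s.
by apply; [rewrite gt_eqF|rewrite ltW// (le_lt_trans t0)].
Unshelve. all: by end_near. Qed.

Lemma near_within_ge0_neq t :
  \forall s \near within [set s | 0 <= s] t^', s != t.
Proof.
rewrite near_withinE; near=> s => _; near: s; exact: nbhs_dnbhs_neq.
Unshelve. all: by end_near. Qed.

(** Caratheodory's form of the derivative avoids changing variables in the
    difference quotient. *)
Lemma has_deriv_ge0_is_derive f t l :
  0 < t -> has_deriv_ge0 f t l -> is_derive t 1 f l.
Proof.
move=> t0 fl; apply/is_derive1_caratheodory.
exists (fun s => if s == t then l else (s - t)^-1 * (f s - f t)); split.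
- move=> s; case: eqP => [->|/eqP st]; first by rewrite !subrr mulr0.
  by field; rewrite subr_eq0.
- apply/continuous_withinNx; rewrite eqxx.
  have {}fl : (fun s => (s - t)^-1 * (f s - f t)) @ t^' --> l.
    by apply: cvg_trans fl; apply: cvg_app; exact: dnbhs_within_ge0.
  apply: cvg_trans fl; apply: near_eq_cvg; near=> s.
  rewrite ifN//; near: s; exact: nbhs_dnbhs_neq.
- by rewrite eqxx.
Unshelve. all: by end_near. Qed.

Lemma is_derive_has_deriv_ge0 f t l : is_derive t 1 f l -> has_deriv_ge0 f t l.
Proof.
move=> /is_derive1_caratheodory[g [gE gc <-]].
have gl : g @ within [set s | 0 <= s] t^' --> g t.
  by apply: cvg_within_filter; exact/continuous_withinNx.
apply: cvg_trans gl; apply: near_eq_cvg; near=> s.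
rewrite gE mulrC mulfK// subr_eq0.
by near: s; exact: near_within_ge0_neq.
Unshelve. all: by end_near. Qed.

Definition continuous_ge0 f t := f @ within [set s | 0 <= s] t^' --> f t.

Lemma has_deriv_ge0_continuous f t l : has_deriv_ge0 f t l -> continuous_ge0 f t.
Proof.
move=> fl; rewrite /continuous_ge0.
have h : (fun s => (s - t) * ((s - t)^-1 * (f s - f t)) + f t)
    @ within [set s | 0 <= s] t^' --> (t - t) * l + f t.
  apply: cvgD; last exact: cvg_cst.
  apply: cvgM fl; apply: cvgB; last exact: cvg_cst.
  by apply: cvg_within_filter; apply: cvg_within_filter; exact: cvg_id.
rewrite subrr mul0r add0r in h.
apply: cvg_trans h; apply: near_eq_cvg; near=> s.
rewrite mulrA mulfV ?mul1r ?subrK// subr_eq0.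
by near: s; exact: near_within_ge0_neq.
Unshelve. all: by end_near. Qed.

Lemma continuous_ge0D f g t : continuous_ge0 f t -> continuous_ge0 g t ->
  continuous_ge0 (fun s => f s + g s) t.
Proof. exact: cvgD. Qed.

Lemma continuous_ge0B f g t : continuous_ge0 f t -> continuous_ge0 g t ->
  continuous_ge0 (fun s => f s - g s) t.
Proof. exact: cvgB. Qed.

Lemma continuous_ge0M f g t : continuous_ge0 f t -> continuous_ge0 g t ->
  continuous_ge0 (fun s => f s * g s) t.
Proof. exact: cvgM. Qed.

Lemma continuous_ge0V f t : continuous_ge0 f t -> f t != 0 ->
  continuous_ge0 (fun s => (f s)^-1) t.
Proof. by move=> cf f0; exact: cvgV. Qed.

Lemma continuous_ge0_within f b : 0 < b ->
  (forall t, 0 <= t -> t <= b -> continuous_ge0 f t) ->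
  {within `[0, b], continuous f}.
Proof.
move=> b0 cf; apply/continuous_within_itvP => //; split.
- move=> t; rewrite in_itv /= => /andP[t0 tb]; apply/continuous_withinNx.
  apply: cvg_trans (cf t (ltW t0) (ltW tb)); apply: cvg_app.
  exact: dnbhs_within_ge0.
- apply: cvg_trans (cf 0 (lexx _) (ltW b0)); apply: cvg_app.
  exact: at_right_within_ge0.
- apply: cvg_trans (cf b (ltW b0) (lexx _)); apply: cvg_app.
  exact: at_left_within_ge0.
Qed.

(** E exp(- K t) has a nonpositive derivative. *)
Lemma gronwall_le0 (E dE : R -> R) K b : 0 < b ->
  {within `[0, b], continuous E} ->
  (forall t, t \in `]0, b[ -> is_derive t 1 E (dE t)) ->
  (forall t, t \in `]0, b[ -> dE t <= K * E t) -> E 0 = 0 -> E b <= 0.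
Proof.
move=> b0 cE dEE dEK E0.
pose w t : R := expR (- K * t).
have dw t : is_derive t 1 w (- K * w t).
  have h : is_derive t 1 ( *%R (- K)) (- K).
    by apply: is_derive_eq; rewrite /GRing.scale /= mulr1.
  have := is_derive1_comp (is_derive_expR (- K * t)) h.
  by rewrite mulrC.
have cw : continuous w.
  by move=> t; apply/differentiable_continuous/derivable1_diffP; case: (dw t).
have dphi t : t \in `]0, b[ ->
    is_derive t 1 (fun t => E t * w t) (E t * (- K * w t) + w t * dE t).
  by move=> tb; exact: (@is_deriveM _ _ E w t 1 _ _ (dEE t tb) (dw t)).
have cphi : {within `[0, b], continuous (fun t => E t * w t)}.
  have cw' : {within `[0, b], continuous w} by exact: continuous_subspaceT.
  by move=> t; have cEt := cE t; have cwt := cw' t; apply: (cvgM cEt cwt).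
have [t tb] := MVT b0 dphi cphi.
rewrite E0 mul0r !subr0 => h.
have w0 s : 0 < w s by exact: expR_gt0.
have : E b * w b <= 0.
  rewrite h pmulr_lle0//.
  have -> : E t * (- K * w t) + w t * dE t = w t * (dE t - K * E t) by ring.
  by rewrite pmulr_rle0// subr_le0; exact: dEK.
by rewrite pmulr_lle0.
Qed.

(** Bounds the derivative of the squared distance of two solutions, which is a
    quadratic form in the differences of alpha and tau. *)
Lemma quadratic_le (A B C x y : R) :
  2 * (A * x ^+ 2 + B * (x * y) + C * y ^+ 2) <=
  (2 * `|A| + `|B| + 2 * `|C|) * (x ^+ 2 + y ^+ 2).
Proof.
have A1 : A * x ^+ 2 <= `|A| * x ^+ 2 by rewrite ler_wpM2r ?sqr_ge0// ler_norm.
have C1 : C * y ^+ 2 <= `|C| * y ^+ 2 by rewrite ler_wpM2r ?sqr_ge0// ler_norm.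
have A2 : 0 <= `|A| * y ^+ 2 by rewrite mulr_ge0 ?sqr_ge0.
have C2 : 0 <= `|C| * x ^+ 2 by rewrite mulr_ge0 ?sqr_ge0.
have B1 : 2 * (B * (x * y)) <= `|B| * (x ^+ 2 + y ^+ 2).
  have B2 : 2 * (B * (x * y)) <= `|B| * (2 * `|x * y|).
    by rewrite mulrCA (le_trans (ler_norm _))// !normrM normr_nat.
  apply: le_trans B2 _; rewrite ler_wpM2l//.
  have := sqr_ge0 (`|x| - `|y|); rewrite normrM sqrrB !real_normK ?num_real//.
  by lra.
lra.
Qed.

(** The squared distance E of two solutions satisfies E' <= K E: the
    difference of the ratios tau / alpha is linear in the differences of alpha
    and tau, with coefficients that are continuous, hence bounded, on [0, b].
    *)
Lemma hopf_ode_unique N P Q (al1 tau1 al2 tau2 : R -> R) b : 0 <= b ->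
  (forall t, 0 <= t -> t <= b -> 0 < al1 t /\ 0 < al2 t) ->
  (forall t, 0 <= t -> t <= b ->
    hopf_ode N P Q al1 tau1 t /\ hopf_ode N P Q al2 tau2 t) ->
  al1 0 = al2 0 -> tau1 0 = tau2 0 -> al1 b = al2 b /\ tau1 b = tau2 b.
Proof.
rewrite le_eqVlt => /predU1P[<-//|b0] pos ode al0 tau0.
pose u1 t := tau1 t / al1 t; pose u2 t := tau2 t / al2 t.
(* u1 - u2 = X (tau1 - tau2) + Y (al1 - al2) *)
pose X t := (al1 t)^-1; pose Y t := - (tau2 t / (al1 t * al2 t)).
pose A t := P * Y t.
pose B t := P * X t + Q * Y t * (u1 t + u2 t).
pose C t := Q * X t * (u1 t + u2 t).
pose k t := 2 * `|A t| + `|B t| + 2 * `|C t|.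
have ck t : 0 <= t -> t <= b -> continuous_ge0 k t.
  move=> t0 tb; have [al10 al20] := pos t t0 tb.
  have [[/has_deriv_ge0_continuous ca1 /has_deriv_ge0_continuous ct1]
        [/has_deriv_ge0_continuous ca2 /has_deriv_ge0_continuous ct2]] := ode t t0 tb.
  have cc (c : R) : continuous_ge0 (fun=> c) t by exact: cvg_cst.
  have nz (f : R -> R) : 0 < f t -> f t != 0 by move=> ?; rewrite gt_eqF.
  have cX : continuous_ge0 X t by apply: continuous_ge0V => //; exact: nz.
  have cY : continuous_ge0 Y t.
    have aa : al1 t * al2 t != 0 by rewrite mulf_neq0 ?nz.
    exact (cvgN (continuous_ge0M ct2 (continuous_ge0V (continuous_ge0M ca1 ca2) aa))).
  have cu : continuous_ge0 (fun t => u1 t + u2 t) t.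
    exact (continuous_ge0D (continuous_ge0M ct1 (continuous_ge0V ca1 (nz _ al10)))
      (continuous_ge0M ct2 (continuous_ge0V ca2 (nz _ al20)))).
  have cn f : continuous_ge0 f t -> continuous_ge0 (fun s => `|f s|) t.
    exact: cvg_norm.
  have cA : continuous_ge0 A t := continuous_ge0M (cc P) cY.
  have cB : continuous_ge0 B t := continuous_ge0D (continuous_ge0M (cc P) cX)
    (continuous_ge0M (continuous_ge0M (cc Q) cY) cu).
  have cC : continuous_ge0 C t := continuous_ge0M (continuous_ge0M (cc Q) cX) cu.
  exact (continuous_ge0D
    (continuous_ge0D (continuous_ge0M (cc 2) (cn _ cA)) (cn _ cB))
    (continuous_ge0M (cc 2) (cn _ cC))).
have [c _ kc] := EVT_max (ltW b0) (continuous_ge0_within b0 ck).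
pose E t := (al1 t - al2 t) ^+ 2 + (tau1 t - tau2 t) ^+ 2.
pose dE t := 2 * (A t * (al1 t - al2 t) ^+ 2
  + B t * ((al1 t - al2 t) * (tau1 t - tau2 t)) + C t * (tau1 t - tau2 t) ^+ 2).
have E0 : E 0 = 0 by rewrite /E al0 tau0 !subrr expr0n addr0.
have : E b <= 0.
  apply: (@gronwall_le0 E dE (k c) b b0) => //.
  - apply: continuous_ge0_within => // t t0 tb.
    have [[/has_deriv_ge0_continuous ca1 /has_deriv_ge0_continuous ct1]
        [/has_deriv_ge0_continuous ca2 /has_deriv_ge0_continuous ct2]] := ode t t0 tb.
    have ca := continuous_ge0B ca1 ca2; have ct := continuous_ge0B ct1 ct2.
    exact (continuous_ge0D (continuous_ge0M ca ca) (continuous_ge0M ct ct)).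
  - move=> t; rewrite in_itv /= => /andP[t0 tb].
    have [al10 al20] := pos t (ltW t0) (ltW tb).
    have [[/(has_deriv_ge0_is_derive t0) da1 /(has_deriv_ge0_is_derive t0) dt1]
          [/(has_deriv_ge0_is_derive t0) da2 /(has_deriv_ge0_is_derive t0) dt2]]
       := ode t (ltW t0) (ltW tb).
    have dE' := is_deriveD (is_deriveX 2 (is_deriveB da1 da2)) (is_deriveX 2 (is_deriveB dt1 dt2)).
    apply: (is_derive_eq dE').
    rewrite /GRing.scale /= /dE /A /B /C /X /Y /u1 /u2 !fctE.
    by field; rewrite !gt_eqF.
  - move=> t tb; apply: (le_trans (quadratic_le _ _ _ _ _)).
    rewrite -/(k t) ler_wpM2r ?addr_ge0 ?sqr_ge0//; apply: kc.
    exact: subset_itv_oo_cc.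
move=> Eb; have : E b == 0 by rewrite eq_le Eb addr_ge0 ?sqr_ge0.
rewrite paddr_eq0 ?sqr_ge0// !sqrf_eq0 !subr_eq0.
by move=> /andP[/eqP -> /eqP ->].
Qed.

End OneSidedCalculus.

(** * Changing time by a positive speed *)

Section TimeChange.
Context {R : realType}.
Implicit Types (f g h : R -> R) (T : \bar R).

Lemma is_derive_continuous f (t l : R) : is_derive t 1 f l -> {for t, continuous f}.
Proof.
by move=> [df _]; apply/differentiable_continuous/derivable1_diffP.
Qed.

(** Integration starts at -1 so that 0 is an interior point and the
    antiderivative is two-sided differentiable there. *)
Lemma antiderivative f : continuous f ->
  exists2 G : R -> R, G 0 = 0 & forall x : R, -1 < x -> is_derive x 1 G (f x).
Proof.
move=> cf; pose F (x : R) : R := (\int[lebesgue_measure]_(t in `[-1, x]) (f t))%R.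
have dF (x : R) : -1 < x -> is_derive x 1 F (f x).
  move=> x1; have xx1 : x < x + 1 by rewrite ltrDl.
  have fi : lebesgue_measure.-integrable `[-1, x + 1] (EFin \o f).
    apply: continuous_compact_integrable; first exact: segment_compact.
    exact: continuous_subspaceT.
  have [dF dFE] : derivable F x 1 /\ derive1 F x = f x.
    exact: continuous_FTC1_closed xx1 fi x1 (cf x).
  apply: (DeriveDef dF); rewrite derive1E in dFE; exact: dFE.
exists (fun x => F x - F 0); first by rewrite subrr.
move=> x x1; have dFx := dF x x1.
have dB := is_deriveB dFx (is_derive_cst (F 0) x 1).
by apply: (is_derive_eq dB); rewrite subr0.
Qed.

Lemma near_time_end T (x : R) : (x%:E < T)%E ->
  \forall t \near time_end T, x < t /\ (t%:E < T)%E.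
Proof.
case: T => [r| |] //=; rewrite ?lte_fin => xr; near=> t; split.
- by near: t; exact: nbhs_left_gt.
- by rewrite lte_fin; near: t; exact: nbhs_left_lt.
- by near: t; exact: nbhs_pinfty_gt.
- exact: ltry.
Unshelve. all: by end_near. Qed.

Lemma time_end_proper T : ProperFilter (time_end T).
Proof. by case: T => [r| |] /=; apply _. Qed.

(** Solves sigma' = 1 / h(sigma) up to the largest possible time.  The last
    clause says that a finite T forces h(sigma t) to come close to 0: if h >=
    e far out, its integral is infinite. *)
Lemma time_change h : continuous h -> (forall s, 0 < h s) ->
  exists (T : \bar R) (sigma : R -> R),
  [/\ (0 < T)%E, sigma 0 = 0,
      forall t : R, 0 <= t -> (t%:E < T)%E ->
        0 <= sigma t /\ is_derive t 1 sigma (h (sigma t))^-1,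
      sigma t @[t --> time_end T] --> +oo &
      forall (r e : R), T = r%:E -> 0 < e ->
        ~ \forall t \near r^'-, e < h (sigma t)].
Proof.
move=> ch h0; have [G G0 dG] := antiderivative ch.
have mvt (x y : R) : -1 < x -> x < y ->
    exists2 c, x < c < y & G y - G x = h c * (y - x).
  move=> x1 xy; have [] := @MVT _ G h x y xy.
  - by move=> z; rewrite in_itv /= => /andP[xz _]; apply: dG; exact: lt_trans xz.
  - apply: derivable_within_continuous => z; rewrite in_itv /= => /andP[xz _].
    by have [] := dG z (lt_le_trans x1 xz).
  - by move=> c; rewrite in_itv /=; exists c.
have inc (x y : R) : -1 < x -> x < y -> G x < G y.
  move=> x1 xy; have [c _ E] := mvt x y x1 xy.
  by rewrite -subr_gt0 E mulr_gt0// subr_gt0.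
have inj (x y : R) : -1 < x -> -1 < y -> G x = G y -> x = y.
  move=> x1 y1 Gxy; have [xy|yx|//] := ltgtP x y.
    by have := inc _ _ x1 xy; rewrite Gxy ltxx.
  by have := inc _ _ y1 yx; rewrite Gxy ltxx.
have N10 : -1 < 0 :> R by rewrite ltrN10.
pose sigma (t : R) := xget 0 [set s : R | -1 < s /\ G s = t].
have sigmaK (s : R) : -1 < s -> sigma (G s) = s.
  move=> s1; rewrite /sigma; case: xgetP => [x _ [x1 Gx]|/(_ s)[]//].
  exact: inj.
pose T := ereal_sup [set (G s)%:E | s in [set s | 0 <= s]].
have GT (s : R) : 0 <= s -> ((G s)%:E < T)%E.
  move=> s0; apply: (@lt_le_trans _ _ (G (s + 1))%:E).
    by rewrite lte_fin; apply: inc; [exact: lt_le_trans s0|rewrite ltrDl].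
  by apply: ereal_sup_ubound; exists (s + 1) => //=; rewrite addr_ge0.
have onto (t : R) : 0 <= t -> (t%:E < T)%E -> exists2 s, 0 <= s & G s = t.
  move=> t0 /ereal_sup_gt[_ [s /= s0 <-]]; rewrite lte_fin => ts.
  have [] := @IVT _ G 0 s t s0.
  - apply: derivable_within_continuous => z; rewrite in_itv /= => /andP[z0 _].
    by have [] := dG z (lt_le_trans N10 z0).
  - by rewrite G0 ge_min t0 /= le_max (ltW ts) orbT.
  - by move=> c; rewrite in_itv /= => /andP[c0 _] Gc; exists c.
have T0 : (0 < T)%E by have := GT 0 (lexx 0); rewrite G0.
exists T, sigma; split=> //.
- by rewrite -G0 sigmaK.
- move=> t t0 tT; have [s s0 <-] := onto t t0 tT.
  have s1 := lt_le_trans N10 s0; rewrite sigmaK//; split=> //.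
  have near1 : \forall x \near s, -1 < x.
    exact: (@cvgr_gt _ _ _ _ id s cvg_id (-1) s1).
  apply: (@is_derive_inverse R G); last by rewrite gt_eqF.
  + by near=> x; apply: sigmaK; near: x.
  + near=> x; apply: (@is_derive_continuous _ _ (h x)); apply: dG; near: x.
    exact: near1.
  + exact: dG.
- have FF := time_end_proper T.
  apply/cvgryPge => A.
  have [M [M0 AM]] : exists M : R, 0 <= M /\ A <= M.
    by exists (Num.max A 0); rewrite !le_max !lexx orbT.
  have := near_time_end (GT _ M0); apply: filterS => t [GMt tT].
  have t0 : 0 <= t.
    apply: le_trans (ltW GMt); rewrite -G0.
    have [->//|M0'] := eqVneq M 0.
    by apply/ltW/inc => //; rewrite lt_def M0'.
  have [s s0 Gs] := onto t t0 tT; rewrite -Gs sigmaK ?(lt_le_trans N10)//.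
  apply: le_trans AM _.
  rewrite leNgt; apply/negP => sM; have := inc _ _ (lt_le_trans N10 s0) sM.
  by rewrite Gs; move/lt_trans => /(_ _ GMt); rewrite ltxx.
- move=> r e Tr e0 [d /= d0 H].
  have r0 : 0 < r by rewrite -lte_fin -Tr.
  pose t0 := Num.max 0 (r - d / 2).
  have t00 : 0 <= t0 by rewrite /t0 le_max lexx.
  have t0r : t0 < r by rewrite /t0 gt_max r0 /= ltrBlDr ltrDl divr_gt0.
  have [c0 c00 Gc0] : exists2 s, 0 <= s & G s = t0 by apply: onto => //; rewrite Tr lte_fin.
  have c01 := lt_le_trans N10 c00.
  (* Past c0 the integrand exceeds e, so it gains more than r on a length r / e. *)
  have c0r : c0 < c0 + r / e by rewrite ltrDl divr_gt0.
  have [c /andP[c0c _]] := mvt c0 (c0 + r / e) c01 c0r.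
  rewrite addrAC subrr add0r => E.
  have c1 : -1 < c by exact: lt_trans c0c.
  have Gcr : G c < r by rewrite -lte_fin -Tr; apply: GT; exact: ltW (le_lt_trans c00 c0c).
  have : e < h c.
    rewrite -(sigmaK c c1); apply: H => //=.
    rewrite ger0_norm ?subr_ge0 ?(ltW Gcr)//.
    have : t0 < G c by rewrite -Gc0; exact: inc.
    rewrite /t0 gt_max => /andP[_]; lra.
  have : G (c0 + r / e) < r.
    by rewrite -lte_fin -Tr; apply: GT; rewrite addr_ge0// ltW// divr_gt0.
  rewrite -(ltrD2r (- G c0)) E => hE ehc.
  have : e * (r / e) < h c * (r / e) by rewrite ltr_pM2r// divr_gt0.
  rewrite mulrC mulfVK ?gt_eqF// => rh.
  have := lt_trans rh hE; rewrite Gc0; lra.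
Unshelve. all: by end_near. Qed.

End TimeChange.

(** * Explicit solution of the system *)

Section ExplicitSolution.
Context {R : realType} (N P delta alpha0 u0 : R).
Hypotheses (N0 : 0 < N) (delta0 : 0 < delta) (al0 : 0 < alpha0) (u00 : 0 < u0).

(** The logistic equation u' = u (N - delta u) has the solution u0 exp(N s) /
    growth s, because growth' / growth = delta u.  The same identity
    integrates alpha' = alpha (- N + P u). *)
Definition growth (s : R) : R := 1 + delta * u0 / N * (expR (N * s) - 1).
(** u in terms of the time s with ds = dt / alpha. *)
Definition ratio_sol (s : R) : R := u0 * expR (N * s) / growth s.
(** alpha in terms of the time s with ds = dt / alpha. *)
Definition alpha_sol (s : R) : R :=
  alpha0 * expR (- N * s + P / delta * ln (growth s)).

Lemma growth_gt0 s : 0 <= s -> 0 < growth s.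
Proof.
move=> s0; rewrite ltr_pwDl// mulr_ge0//.
  by rewrite ltW// divr_gt0// mulr_gt0.
by rewrite subr_ge0 -expR0 ler_expR mulr_ge0// ltW.
Qed.

Lemma growth0 : growth 0 = 1.
Proof. by rewrite /growth mulr0 expR0 subrr mulr0 addr0. Qed.

Lemma ratio_sol0 : ratio_sol 0 = u0.
Proof. by rewrite /ratio_sol growth0 mulr0 expR0 mulr1 divr1. Qed.

Lemma alpha_sol0 : alpha_sol 0 = alpha0.
Proof. by rewrite /alpha_sol growth0 ln1 !mulr0 addr0 expR0 mulr1. Qed.

Lemma ratio_sol_gt0 s : 0 <= s -> 0 < ratio_sol s.
Proof. by move=> s0; rewrite divr_gt0 ?growth_gt0// mulr_gt0// expR_gt0. Qed.

Lemma alpha_sol_gt0 s : 0 < alpha_sol s.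
Proof. by rewrite mulr_gt0// expR_gt0. Qed.

Lemma is_derive_lin (c s : R) : is_derive s 1 (fun s => c * s) c.
Proof.
have h := is_deriveZ c (is_derive_id s (1 : R)).
by apply: (is_derive_eq h); rewrite /GRing.scale /= mulr1.
Qed.

Lemma is_derive_exp_lin (c s : R) :
  is_derive s 1 (fun s => expR (c * s)) (c * expR (c * s)).
Proof.
have h := is_derive1_comp (is_derive_expR (c * s)) (is_derive_lin c s).
by apply: (is_derive_eq h); rewrite mulrC.
Qed.

Lemma is_derive_growth (s : R) :
  is_derive s 1 growth (delta * u0 * expR (N * s)).
Proof.
have h := is_deriveD (is_derive_cst (1 : R) s (1 : R))
  (is_deriveZ (delta * u0 / N)
    (is_deriveB (is_derive_exp_lin N s) (is_derive_cst (1 : R) s (1 : R)))).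
apply: (is_derive_eq h); rewrite /GRing.scale /= subr0 add0r.
by field; rewrite gt_eqF.
Qed.

Lemma is_derive_ratio_sol (s : R) : 0 <= s ->
  is_derive s 1 ratio_sol (ratio_sol s * (N - delta * ratio_sol s)).
Proof.
move=> s0; have g0 := growth_gt0 s0; have gn : growth s != 0 by rewrite gt_eqF.
have h := is_deriveM (is_deriveZ u0 (is_derive_exp_lin N s))
  (is_deriveV gn (is_derive_growth s)).
apply: (is_derive_eq h); rewrite /= /GRing.scale /= /ratio_sol.
by field.
Qed.

Lemma is_derive_alpha_sol (s : R) : 0 <= s ->
  is_derive s 1 alpha_sol (alpha_sol s * (- N + P * ratio_sol s)).
Proof.
move=> s0; have g0 := growth_gt0 s0; have gn : growth s != 0 by rewrite gt_eqF.
have hl := is_derive1_comp (is_derive1_ln g0) (is_derive_growth s).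
have he := is_deriveD (is_derive_lin (- N) s) (is_deriveZ (P / delta) hl).
have h := is_deriveZ alpha0 (is_derive1_comp (is_derive_expR _) he).
apply: (is_derive_eq h); rewrite /GRing.scale /= /alpha_sol /ratio_sol.
rewrite -[X in expR X]/(- N * s + P / delta * ln (growth s)).
by field; rewrite gn gt_eqF.
Qed.

Lemma ratio_sol_cvg : ratio_sol s @[s --> +oo] --> N / delta.
Proof.
pose k := delta * u0 / N.
have k0 : k != 0 by rewrite gt_eqF// divr_gt0// mulr_gt0.
have e0 : expR (- (N * s)) @[s --> +oo] --> (0 : R).
  have Ns : N * s @[s --> +oo] --> +oo.
    by apply: gt0_cvgMry => //; exact: cvg_id.
  exact: (cvg_comp _ _ Ns (@cvgr_expR R)).
have -> : N / delta = u0 / (0 * (1 - k) + k).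
  by rewrite mul0r add0r /k; field; rewrite !gt_eqF.
have d0 : 0 * (1 - k) + k != 0 by rewrite mul0r add0r.
have h : u0 / (expR (- (N * s)) * (1 - k) + k) @[s --> +oo] -->
    u0 / (0 * (1 - k) + k).
  apply: cvgM; first exact: cvg_cst.
  apply: cvgV => //; apply: cvgD; last exact: cvg_cst.
  by apply: cvgM => //; exact: cvg_cst.
apply: cvg_trans h; apply: near_eq_cvg; near=> s.
have s0 : 0 <= s by near: s; exact: nbhs_pinfty_ge.
have g0 := growth_gt0 s0; rewrite /ratio_sol expRN.
have ge : growth s = expR (N * s) * ((expR (N * s))^-1 * (1 - k) + k).
  by rewrite /growth -/k; field; rewrite gt_eqF ?expR_gt0.
have e0' : expR (N * s) != 0 by rewrite gt_eqF ?expR_gt0.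
rewrite ge in g0 *.
have g1 : (expR (N * s))^-1 * (1 - k) + k != 0.
  by apply: contraTneq g0 => ->; rewrite mulr0 ltxx.
by rewrite invfM mulrA mulfK.
Unshelve. all: by end_near. Qed.

(** [alpha_sol] is only under control for s >= 0, while [time_change] wants a
    speed on the whole line. *)
Lemma continuous_alpha_sol_max : continuous (fun s : R => alpha_sol (Num.max s 0)).
Proof.
move=> s; apply: (@continuous_comp _ _ _ (fun s : R => Num.max s 0) alpha_sol).
  by apply: continuous_max; [exact: cvg_id|exact: cvg_cst].
have m0 : 0 <= Num.max s 0 by rewrite le_max lexx orbT.
exact: (is_derive_continuous (is_derive_alpha_sol m0)).
Qed.

(** Composes the explicit solution in s with the inverse of t(s), the integral
    of alpha. *)
Lemma hopf_ode_solution : exists (T : \bar R) (alpha u : R -> R),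
  [/\ (0 < T)%E, alpha 0 = alpha0, u 0 = u0,
      forall t : R, 0 <= t -> (t%:E < T)%E ->
        [/\ 0 < alpha t, 0 < u t &
            hopf_ode N P (P - delta) alpha (fun t => alpha t * u t) t] &
      u t @[t --> time_end T] --> N / delta /\
      forall r e : R, T = r%:E -> 0 < e -> ~ \forall t \near r^'-, e < alpha t].
Proof.
pose h (s : R) := alpha_sol (Num.max s 0).
have [T [sigma [T0 sigma0 dsigma sigmay Tr]]] :=
  @time_change R h continuous_alpha_sol_max (fun s => alpha_sol_gt0 _).
have hE s : 0 <= s -> h s = alpha_sol s by move=> s0; rewrite /h max_l.
exists T, (fun t => alpha_sol (sigma t)), (fun t => ratio_sol (sigma t)).
split.
- exact: T0.
- by rewrite sigma0 alpha_sol0.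
- by rewrite sigma0 ratio_sol0.
- move=> t t0 tT; have [s0 ds] := dsigma t t0 tT.
  have as0 := alpha_sol_gt0 (sigma t); rewrite hE// in ds.
  have an : alpha_sol (sigma t) != 0 by rewrite gt_eqF.
  have da := is_derive1_comp (is_derive_alpha_sol s0) ds.
  have du := is_derive1_comp (is_derive_ratio_sol s0) ds.
  split; [exact: as0|exact: ratio_sol_gt0|].
  split; apply: is_derive_has_deriv_ge0.
    by apply: (is_derive_eq da); field.
  apply: (is_derive_eq (is_deriveM da du)); rewrite /GRing.scale /=.
  by field.
- split; last first.
    move=> r e TrE e0 H; apply: (Tr r e TrE e0).
    have r0 : 0 < r by rewrite -lte_fin -TrE.
    near=> t; rewrite hE; first by near: t; exact: H.
    have t0 : 0 <= t by near: t; exact: nbhs_left_ge.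
    have tr : t < r by near: t; exact: nbhs_left_lt.
    by have [] := dsigma t t0 (_ : (t%:E < T)%E); rewrite ?TrE ?lte_fin.
  exact: (cvg_comp _ _ sigmay ratio_sol_cvg).
Unshelve. all: by end_near. Qed.

End ExplicitSolution.

(** * Static metrics, existence, uniqueness and convergence *)

Section MainParts.
Context {R : realType} {n : nat} (mu : 'rV[R[i]]_n) (a b c d : R).
Hypotheses (hn : (0 < n)%N) (hmu : hopf_multiplier mu).
Hypothesis hF : hopf_F a b c d n < n%:R.
Let F := hopf_F a b c d n.
Let delta := n%:R - F.
Let gamma := F / (n%:R - F).

Let delta0 : 0 < delta. Proof. by rewrite subr_gt0. Qed.

(** The origin of F: (tau' - u alpha') / alpha, the derivative of u, is u (n -
    (P - Q) u) / alpha. *)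
Lemma coefQE : coefQ n a c = coefP n a b d - (n%:R - hopf_F a b c d n).
Proof. by rewrite /coefQ /coefP /hopf_F; ring. Qed.

Let gamma1 : 1 + gamma = n%:R / delta.
Proof.
have d0 : n%:R - F != 0 by rewrite gt_eqF.
by rewrite /gamma /delta; field.
Qed.

Lemma hopf_metricZ (k x y : R) (z : 'rV[R[i]]_n) :
  k%:C%C *: hopf_metric x y z = hopf_metric (k * x) (k * y) z.
Proof. by apply/matrixP => i j; rewrite !mxE /=; ring. Qed.

(** An infinite final time leaves nothing to extend; past a finite one, an
    extension would keep the diagonal entry away from 0
    ([extension_bounded_below]). *)
Lemma hcf_maximal_of_degenerate (T : \bar R) (g : R -> 'rV[R[i]]_n -> 'M[R[i]]_n)
    (z : 'rV[R[i]]_n) (i : 'I_n) (f : R -> R) :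
  z != 0 -> hcf_solution mu a b c d T g ->
  (forall s : R, 0 <= s -> (s%:E < T)%E -> g s z i i = (f s)%:C%C) ->
  (forall r e : R, T = r%:E -> 0 < e -> ~ \forall s \near r^'-, e < f s) ->
  hcf_maximal mu a b c d T g.
Proof.
move=> z0 sol gf deg; split=> // T' g' TT' sol' gg'.
case: T => [r| |] in sol gf deg TT' gg' *.
- have r0 : 0 < r by case: sol => +_; rewrite lte_fin.
  have [|e e0 H] := @extension_bounded_below R n mu a b c d r T' g' z i f r0 TT' sol' z0.
    move=> s s0 sr; have sT : (s%:E < r%:E)%E by rewrite lte_fin.
    by rewrite gg'// gf.
  exact: deg H.
- by have := lt_le_trans TT' (leey T'); rewrite ltxx.
- by case: sol => + _; rewrite ltNge leNye.
Qed.

(** At the rest point u = n / (n - F), both alpha and tau are affine in t and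
    stay proportional.  If their slope A is negative the metric shrinks to 0
    at time lambda / (- A); otherwise the flow is eternal. *)
Lemma hopf_metric_static (lambda : R) : 0 < lambda ->
  static_metric mu a b c d (fun z => lambda%:C%C *: hopf_metric 1 gamma z).
Proof.
move=> l0; pose u : R := n%:R / delta.
have u0 : 0 < u by rewrite divr_gt0// ltr0n.
pose A : R := - n%:R + coefP n a b d * u.
have AQ : A * u = coefQ n a c * u ^+ 2.
  rewrite coefQE -/F -/delta /A /u; field.
  by rewrite gt_eqF.
pose al t : R := lambda + A * t.
pose T : \bar R := if 0 <= A then +oo%E else (lambda / - A)%:E.
have T0 : (0 < T)%E.
  rewrite /T; case: ifPn => [_|]; first exact: ltry.
  by rewrite -ltNge lte_fin => A0; rewrite divr_gt0// oppr_gt0.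
have al_gt0 t : 0 <= t -> (t%:E < T)%E -> 0 < al t.
  rewrite /T /al => t0; case: ifPn => [A0 _|]; first by rewrite ltr_pwDl// mulr_ge0.
  rewrite -ltNge => A0; rewrite lte_fin ltr_pdivlMr ?oppr_gt0//; lra.
pose be t := al t * gamma.
have tauEt t : al t + be t = al t * u by rewrite /be /u -gamma1; ring.
have tauE : (fun t => al t + be t) = (fun t => al t * u) by apply/funext.
pose g t := @hopf_metric R n (al t) (be t).
have sol : hcf_solution mu a b c d T g.
  apply: hopf_solution_of_ode => //.
    move=> t t0 tT; have at0 := al_gt0 t t0 tT; split=> //.
    by rewrite -subr_gt0 opprK addrC tauEt mulr_gt0.
  move=> t t0 tT; have at0 := al_gt0 t t0 tT; rewrite tauE.
  have uE : al t * u / al t = u by rewrite mulrC mulKf ?gt_eqF.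
  have dal : is_derive t 1 al A.
    have h := is_deriveD (is_derive_cst lambda t (1 : R)) (is_derive_lin A t).
    by apply: (is_derive_eq h); rewrite add0r.
  split; rewrite uE; first exact: (is_derive_has_deriv_ge0 dal).
  apply: is_derive_has_deriv_ge0.
  have h := is_deriveM dal (is_derive_cst u t (1 : R)).
  by apply: (is_derive_eq h); rewrite /GRing.scale /= mulr0 add0r mulrC.
exists T, g; split.
- pose i0 : 'I_n := Ordinal hn.
  apply: (@hcf_maximal_of_degenerate T g 'e_i0 i0 (fun t => al t * u) (delta_neq0 _) sol).
    by move=> s s0 sT; rewrite /g hopf_metric_delta_same tauEt.
  move=> r e; rewrite /T; case: ifPn => // ; rewrite -ltNge => A0 [rE] e0 H.
  have f0 : al t * u @[t --> r^'-] --> 0.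
    (* r = lambda / (- A) is the zero of al. *)
    have -> : 0 = (lambda + A * r) * u.
      by rewrite -rE; field; rewrite lt_eqF.
    apply: cvgM; last exact: cvg_cst.
    apply: cvgD; first exact: cvg_cst.
    apply: cvgM; first exact: cvg_cst.
    by apply: cvg_at_left_filter; exact: cvg_id.
  have fe : \forall t \near r^'-, al t * u < e by exact: (cvgr_lt _ f0).
  near r^'- => t.
  have et : e < al t * u by near: t; exact: H.
  have te : al t * u < e by near: t; exact: fe.
  by have := lt_trans et te; rewrite ltxx.
- move=> z z0; rewrite hopf_metricZ /g /be /al.
  by rewrite mulr0 addr0 mulr1.
- move=> t t0 tT; have at0 := al_gt0 t t0 tT.
  exists (al t / lambda); first by rewrite divr_gt0.
  move=> z z0; rewrite !hopf_metricZ /g /be; congr (hopf_metric _ _ z).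
    by rewrite mulr1 divfK ?gt_eqF.
  by rewrite mulrA divfK ?gt_eqF.
Unshelve. all: by end_near. Qed.

(** On the common interval the flows agree; if one lived longer, it would
    extend the other. *)
Lemma hopf_flow_unique (alpha0 beta0 : R) T1 T2 al1 be1 al2 be2 : (1 < n)%N ->
  hopf_flow mu a b c d alpha0 beta0 T1 al1 be1 ->
  hopf_flow mu a b c d alpha0 beta0 T2 al2 be2 ->
  T2 = T1 /\ forall t : R, 0 <= t -> (t%:E < T1)%E -> al2 t = al1 t /\ be2 t = be1 t.
Proof.
move=> n1 [a1 b1 pos1 [sol1 max1]] [a2 b2 pos2 [sol2 max2]].
have agree t : 0 <= t -> (t%:E < T1)%E -> (t%:E < T2)%E -> al2 t = al1 t /\ be2 t = be1 t.
  move=> t0 tT1 tT2.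
  have lt1 s : s <= t -> (s%:E < T1)%E by move=> st; apply: le_lt_trans tT1; rewrite lee_fin.
  have lt2 s : s <= t -> (s%:E < T2)%E by move=> st; apply: le_lt_trans tT2; rewrite lee_fin.
  have [] := @hopf_ode_unique R n%:R (coefP n a b d) (coefQ n a c) al2 (fun t => al2 t + be2 t)
      al1 (fun t => al1 t + be1 t) t t0.
  - move=> s s0 st; split; first by have [] := pos2 s s0 (lt2 s st).
    by have [] := pos1 s s0 (lt1 s st).
  - move=> s s0 st; split; first exact: hopf_ode_of_solution sol2 _ s0 (lt2 s st).
    exact: hopf_ode_of_solution sol1 _ s0 (lt1 s st).
  - by rewrite a1 a2.
  - by rewrite a1 a2 b1 b2.
  - by move=> -> /addrI ->.
have TT : T2 = T1.
  apply/eqP; rewrite eq_le !leNgt; apply/andP; split; apply/negP => lt.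
    apply: (max1 _ _ lt sol2) => t z t0 tT _.
    by have [-> ->] := agree t t0 tT (lt_trans tT lt).
  apply: (max2 _ _ lt sol1) => t z t0 tT _.
  by have [-> ->] := agree t t0 (lt_trans tT lt) tT.
by split=> // t t0 tT; apply: agree => //; rewrite TT.
Qed.

Lemma hopf_flow_exists (alpha0 beta0 : R) : (1 < n)%N -> 0 < alpha0 -> - alpha0 < beta0 ->
  exists T al be, hopf_flow mu a b c d alpha0 beta0 T al be /\
     be t / al t @[t --> time_end T] --> gamma.
Proof.
move=> n1 al0 be0; have tau0 : 0 < alpha0 + beta0 by rewrite -(opprK alpha0) addrC subr_gt0.
have N0 : 0 < n%:R :> R by rewrite ltr0n.
have [T [al [u [T0 ali ui ode [ucvg deg]]]]] :=
  hopf_ode_solution (coefP n a b d) N0 delta0 al0 (divr_gt0 tau0 al0).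
pose be t := al t * u t - al t.
have tauEt t : al t + be t = al t * u t by rewrite /be; ring.
have tauE : (fun t => al t + be t) = (fun t => al t * u t) by apply/funext.
exists T, al, be; split; last first.
  have FF := time_end_proper T.
  have h : u t - 1 @[t --> time_end T] --> n%:R / delta - 1.
    by apply: cvgB => //; exact: cvg_cst.
  rewrite -gamma1 addrAC subrr add0r in h.
  apply: cvg_trans h; apply: near_eq_cvg.
  have := near_time_end T0; apply: filterS => t [t0 tT].
  have [at0 _ _] := ode t (ltW t0) tT.
  by rewrite /be; field; rewrite gt_eqF.
have pos t : 0 <= t -> (t%:E < T)%E -> 0 < al t /\ - al t < be t.
  move=> t0 tT; have [at0 ut0 _] := ode t t0 tT; split=> //.
  by rewrite -subr_gt0 opprK addrC tauEt mulr_gt0.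
split=> //.
  by rewrite /be ali ui mulrC divfK ?gt_eqF// addrC addKr.
have sol : hcf_solution mu a b c d T (fun t => hopf_metric (al t) (be t)).
  apply: hopf_solution_of_ode => // t t0 tT.
  by rewrite tauE coefQE; have [] := ode t t0 tT.
pose i0 : 'I_n := Ordinal hn; pose i1 : 'I_n := Ordinal n1.
have i10 : i1 != i0 by [].
apply: (hcf_maximal_of_degenerate (i := i1) (delta_neq0 i0) sol _ deg).
by move=> s s0 sT; rewrite hopf_metric_delta_other.
Qed.

End MainParts.

Unset Implicit Arguments.
Theorem theorem4 (R : realType) (n : nat) (mu : 'rV[R[i]]_n) (a b c d : R)
    (hn : (0 < n)%N) (hmu : hopf_multiplier mu)
    (hF : hopf_F a b c d n < n%:R) :
  let F := hopf_F a b c d n in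
  let gamma := F / (n%:R - F) in
  (forall lambda : R, 0 < lambda ->
     static_metric mu a b c d (fun z => lambda%:C%C *: hopf_metric 1 gamma z))
  /\
  ((1 < n)%N ->
   forall alpha0 beta0 : R, 0 < alpha0 -> - alpha0 < beta0 ->
   exists (T : \bar R) (alpha beta : R -> R),
     [/\ hopf_flow mu a b c d alpha0 beta0 T alpha beta,
         beta t / alpha t @[t --> time_end T] --> gamma &
         forall (T' : \bar R) (alpha' beta' : R -> R),
           hopf_flow mu a b c d alpha0 beta0 T' alpha' beta' ->
           T' = T /\
           forall t : R, 0 <= t -> (t%:E < T)%E ->
             alpha' t = alpha t /\ beta' t = beta t]).
Proof.
move=> F gamma; split=> [lambda l0|n1 alpha0 beta0 al0 be0].
  exact: hopf_metric_static.
have [T [al [be [flow cv]]]] :=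
  hopf_flow_exists hn hmu hF n1 al0 be0.
exists T, al, be; split=> // T' al' be' flow'.
exact: hopf_flow_unique n1 flow flow'.
Qed.
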